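(* Let $f:\mathbb{R}^d\to\mathbb{R}$ be a quadratic function with constant Hessian $H$, $L$-smooth and $\sigma$-strongly convex. Suppose $\zeta\ge L$ and $\tau\le\sigma$, and let $(\Sigma_k)_{k\ge1}$ be generated by the algorithm MiNES (with batch size $b=1$) with step sizes $\eta_2^{(k)}=\frac1k$. Then for all $k\ge1$, $$\mathbb{E}\left[\left\|\Sigma_k^{-1}-H\right\|^2\right]\le\frac1k\cdot\max\left\{\left\|\Sigma_1^{-1}-H\right\|^2,\ M\right\},$$ where $$M=\frac{L^2\zeta^2}{4\tau^2}\left(d^4+11d^3+34d^2+32d\right)+2d\zeta^2+\|H\|^2 .$$
   Context: Norms on matrices are Frobenius norms. Constants $\alpha>0$ and $0<\tau\le\zeta$ are fixed. $\mathcal{S}=\{\Sigma \text{ symmetric } d\times d:\ \zeta^{-1}I\preceq\Sigma\preceq\tau^{-1}I\}$ and $\mathcal{S}'=\{\Sigma^{-1}:\Sigma\in\mathcal{S}\}$; $\Pi_{\mathcal{S}'}(A)=\operatorname*{arg\,min}_{X\in\mathcal{S}'}\|A-X\|$ for symmetric $A$. $L$-smooth means $\nabla f$ is $L$-Lipschitz; $\sigma$-strongly convex means $f(x)-f(y)\ge\langle\nabla f(y),x-y\rangle+\frac{\sigma}{2}\|x-y\|^2$ for all $x,y$. (So $\sigma I\preceq H\preceq LI$.) MiNES with $b=1$: start from deterministic $\mu_1\in\mathbb{R}^d$ and $\Sigma_1\in\mathcal{S}$. At iteration $k=1,2,\dots$ draw $u_k\sim N(0,I_d)$ independently of the past and set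 $$\tilde g(\mu_k)=\frac{f(\mu_k+\alpha\Sigma_k^{1/2}u_k)-f(\mu_k-\alpha\Sigma_k^{1/2}u_k)}{2\alpha}\,\Sigma_k^{1/2}u_k,$$ $$\tilde G(\Sigma_k)=\frac{1}{2\alpha^2}\left(f(\mu_k-\alpha\Sigma_k^{1/2}u_k)+f(\mu_k+\alpha\Sigma_k^{1/2}u_k)-2f(\mu_k)\right)\left(\Sigma_k^{-1/2}u_ku_k^\top\Sigma_k^{-1/2}-\Sigma_k^{-1}\right)-\Sigma_k^{-1},$$ $$\mu_{k+1}=\mu_k-\eta_1^{(k)}\tilde g(\mu_k),\qquad \Sigma_{k+1}^{-1}=\Pi_{\mathcal{S}'}\left(\Sigma_k^{-1}+\eta_2^{(k)}\tilde G(\Sigma_k)\right),$$ with step sizes $\eta_1^{(k)},\eta_2^{(k)}>0$. *)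

(* Defs.v *)
From HB Require Import structures.
From mathcomp Require Import all_boot all_order all_algebra.
From mathcomp Require Import all_classical all_reals all_analysis.

Set Implicit Arguments.
Unset Strict Implicit.
Unset Printing Implicit Defensive.

Import Order.TTheory GRing.Theory Num.Theory.
Import numFieldNormedType.Exports.
Local Open Scope classical_set_scope.
Local Open Scope ring_scope.

Section Matrices.
Context {R : realType}.

Definition dotv d (x y : 'cV[R]_d) : R := (x^T *m y) 0 0.

(* The norm that the library puts on 'M[R]_(m, n) is the sup norm; all norms
   here are Frobenius norms (the Euclidean norm on column vectors). *)
Definition frob m n (A : 'M[R]_(m, n)) : R :=
  Num.sqrt (\sum_i \sum_j A i j ^+ 2).

Definition symmetric_mx d (A : 'M[R]_d) : Prop := A^T = A.

Definition psd d (A : 'M[R]_d) : Prop :=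
  symmetric_mx A /\ forall x : 'cV[R]_d, 0 <= dotv x (A *m x).

Definition loewner d (A B : 'M[R]_d) : Prop := psd (B - A).

(* The set S, and S' = { Sigma^-1 : Sigma in S }. *)
Definition covset d (tau zeta : R) : set 'M[R]_d :=
  [set Sg | [/\ symmetric_mx Sg, loewner (zeta^-1)%:M Sg
              & loewner Sg (tau^-1)%:M]].

Definition precset d (tau zeta : R) : set 'M[R]_d :=
  (fun Sg => invmx Sg) @` covset tau zeta.

(* [is_sqrtm A T]: T = A^(1/2), the (unique) psd square root. *)
Definition is_sqrtm d (A T : 'M[R]_d) : Prop := psd T /\ T *m T = A.

(* [is_proj C A X]: X = argmin_(Y in C) ||A - Y||; the minimizer is unique
   when C is convex and closed, as S' is. *)
Definition is_proj d (C : set 'M[R]_d) (A X : 'M[R]_d) : Prop :=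
  C X /\ forall Y, C Y -> frob (A - X) <= frob (A - Y).

End Matrices.

Section Functions.
Context {R : realType} {d : nat}.
Implicit Types (f : 'cV[R]_d -> R) (x y : 'cV[R]_d).

Definition basisv (i : 'I_d) : 'cV[R]_d := delta_mx i 0.

Definition gradient f x : 'cV[R]_d := \col_i 'D_(basisv i) f x.

Definition hessian f x : 'M[R]_d :=
  \matrix_(i, j) 'D_(basisv i) (fun y => 'D_(basisv j) f y) x.

Definition quadratic f : Prop :=
  exists (Q : 'M[R]_d) (b : 'cV[R]_d) (c : R),
    forall x, f x = dotv x (Q *m x) + dotv b x + c.

Definition smooth (L : R) f : Prop :=
  forall x y, frob (gradient f x - gradient f y) <= L * frob (x - y).

Definition strongly_convex (sigma : R) f : Prop :=
  forall x y,
    f x - f y >= dotv (gradient f y) (x - y) + sigma / 2 * frob (x - y) ^+ 2.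

End Functions.

Section Probability.
Context {R : realType} {dsp : measure_display} {T : measurableType dsp}.
Variable P : probability T R.
Local Open Scope ereal_scope.

Definition coords d (v : T -> 'cV[R]_d) (i : 'I_d) (w : T) : R := v w i 0%R.

(* v ~ N(0, I_d): its law is the d-fold product of N(0, 1), given here by its
   values on measurable boxes. *)
Definition std_gaussian d (v : T -> 'cV[R]_d) : Prop :=
  (forall i, measurable_fun [set: T] (coords v i)) /\
  forall A : 'I_d -> set R, (forall i, measurable (A i)) ->
    P (\bigcap_i (coords v i @^-1` A i)) =
    \big[*%E/1]_(i < d) normal_prob 0%R 1%R (A i).

Definition indep_sys (F G : set (set T)) : Prop :=
  forall A B, F A -> G B -> P (A `&` B) = P A * P B.

Definition sigma_vec d (v : T -> 'cV[R]_d) : set (set T) :=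
  g_sigma_preimage (coords v).

(* sigma(u_1, ..., u_(k-1)) *)
Definition sigma_past d (u : nat -> T -> 'cV[R]_d) (k : nat) : set (set T) :=
  <<s \bigcup_(j in [set j | (0 < j < k)%N]) sigma_vec (u j) >>.

Definition gaussian_draws d (u : nat -> T -> 'cV[R]_d) : Prop :=
  forall k, (0 < k)%N ->
    std_gaussian (u k) /\ indep_sys (sigma_vec (u k)) (sigma_past u k).

End Probability.

Section MiNES.
Context {R : realType} {d : nat}.
Variables (f : 'cV[R]_d -> R) (alpha : R).

(* In the two estimators Rt stands for Sigma^(1/2). *)
Definition mines_g (mu : 'cV[R]_d) (Rt : 'M[R]_d) (u : 'cV[R]_d) : 'cV[R]_d :=
  ((f (mu + alpha *: (Rt *m u)) - f (mu - alpha *: (Rt *m u))) / (2 * alpha))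
    *: (Rt *m u).

Definition mines_G (mu : 'cV[R]_d) (Sigma Rt : 'M[R]_d) (u : 'cV[R]_d) :
    'M[R]_d :=
  ((2 * alpha ^+ 2)^-1 *
     (f (mu - alpha *: (Rt *m u)) + f (mu + alpha *: (Rt *m u)) - 2 * f mu))
    *: (invmx Rt *m u *m u^T *m invmx Rt - invmx Sigma) - invmx Sigma.

(* The iterates are indexed from 1; the values at 0 are irrelevant.  Note that
   [invmx] is the identity on singular matrices, so that
   [invmx (Sigma k.+1 w)] lying in S' forces [Sigma k.+1 w] to be in S. *)
Definition mines (tau zeta : R) (eta1 eta2 : nat -> R) (mu1 : 'cV[R]_d)
    (Sigma1 : 'M[R]_d) (T : Type) (u : nat -> T -> 'cV[R]_d)
    (mu : nat -> T -> 'cV[R]_d) (Sigma : nat -> T -> 'M[R]_d) : Prop :=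
  (forall w, mu 1%N w = mu1 /\ Sigma 1%N w = Sigma1) /\
  forall k w, (0 < k)%N -> exists Rt, [/\
    is_sqrtm (Sigma k w) Rt,
    mu k.+1 w = mu k w - eta1 k *: mines_g (mu k w) Rt (u k w)
  & is_proj (precset tau zeta)
      (invmx (Sigma k w) +
         eta2 k *: mines_G (mu k w) (Sigma k w) Rt (u k w))
      (invmx (Sigma k.+1 w))].

End MiNES.

(* Main.v *)
Require Import Defs.
From HB Require Import structures.
From mathcomp Require Import all_boot all_order all_algebra.
From mathcomp Require Import all_classical all_reals all_analysis.
From mathcomp Require Import measurable_realfun.
From mathcomp Require Import ring lra.
From mathcomp Require mpoly.
Set Implicit Arguments.
Unset Strict Implicit.
Unset Printing Implicit Defensive.
Import Order.TTheory GRing.Theory Num.Theory.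
Import -(notations) mpoly.
Import numFieldNormedType.Exports.
Local Open Scope classical_set_scope.
Local Open Scope ring_scope.

(* Write X_k = Sigma_k^-1, R = Sigma_k^(1/2), W = R^-1.  For a quadratic f the
   second difference is exact, so the estimator is Y - X_k with
   Y = 1/2 (u^T R H R u) W (u u^T - I) W, and Gaussian integration by parts gives
   E[Y | past] = H and E|Y|^2 <= K, the first term of M.  Since H lies in S',
   which is {X : tau I <= X <= zeta I} and convex, the projection does not
   increase the distance to H, whence with e_k = E|X_k - H|^2
     e_(k+1) <= (1 - 2/k) e_k + M/k^2.
   Induction gives the rate for k >= 2.  The first step (where 1 - 2/k < 0) does
   not follow from this recursion; there e_2 <= M/2 holds because S' is bounded
   and L >= tau makes K at least 8 d zeta^2.
   Conditioning is replaced by independence, which requires X_k to be measurable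
   with respect to the past although R and the projection are only specified
   implicitly: this follows from their Lipschitz dependence on the data. *)

(** * Frobenius inner product and Loewner bounds *)

(** Origin of M: with eta = 1/k the error before projection is a + eta Y, where a = (1 - eta) X - H.
    Replacing E<a, Y> by E<a, H> and completing the square turns the terms without |Y|^2 into (1 -
    eta)^2 |X - H|^2 - eta^2 |H|^2. Bounding the eta^2 share of |X - H|^2 by 2 |X|^2 + 2 |H|^2
    leaves eta^2 (2 d zeta^2 + |H|^2). The polynomial in d is E[s^2 (s^2 - 2 s + d)] for s = |u|^2,
    because |u u^T - I|^2 = s^2 - 2 s + d. The mean of Y is H because subtracting I from u u^T
    removes one of the three pairings in the fourth moment; the other two agree by symmetry and
    cancel the factor 1/2. Matrix estimates come from Cauchy-Schwarz for quadratic forms, without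
    eigenvalues. Integration by parts in dimension d is done on formal polynomials, so real analysis
    enters only through the power moments in dimension one. *)

Section FrobeniusProduct.
Context {R : realType}.

Definition ip m n (A B : 'M[R]_(m, n)) : R := \tr (A^T *m B).

Lemma ipE m n (A B : 'M[R]_(m, n)) : ip A B = \sum_i \sum_j A i j * B i j.
Proof.
rewrite /ip /mxtrace exchange_big /=; apply: eq_bigr => j _.
by rewrite mxE; apply: eq_bigr => i _; rewrite mxE.
Qed.

Lemma frob_sqr m n (A : 'M[R]_(m, n)) : frob A ^+ 2 = ip A A.
Proof.
rewrite /frob sqr_sqrtr ?ipE//; apply: sumr_ge0 => i _; apply: sumr_ge0 => j _.
exact: sqr_ge0.
Qed.

Lemma frob_ge0 m n (A : 'M[R]_(m, n)) : 0 <= frob A.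
Proof. exact: sqrtr_ge0. Qed.

Lemma frob_le m n p q (A : 'M[R]_(m, n)) (B : 'M[R]_(p, q)) :
  (frob A <= frob B) = (ip A A <= ip B B).
Proof. by rewrite -!frob_sqr ler_sqr ?nnegrE ?frob_ge0. Qed.

Lemma ip_ge0 m n (A : 'M[R]_(m, n)) : 0 <= ip A A.
Proof. by rewrite -frob_sqr sqr_ge0. Qed.

Lemma ipC m n (A B : 'M[R]_(m, n)) : ip A B = ip B A.
Proof. by rewrite /ip -mxtrace_tr trmx_mul trmxK. Qed.

Lemma ipDr m n (A B C : 'M[R]_(m, n)) : ip A (B + C) = ip A B + ip A C.
Proof. by rewrite /ip mulmxDr mxtraceD. Qed.

Lemma ipDl m n (A B C : 'M[R]_(m, n)) : ip (A + B) C = ip A C + ip B C.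
Proof. by rewrite ipC ipDr !(ipC C). Qed.

Lemma ipZr m n (A B : 'M[R]_(m, n)) c : ip A (c *: B) = c * ip A B.
Proof. by rewrite /ip -scalemxAr mxtraceZ. Qed.

Lemma ipZl m n (A B : 'M[R]_(m, n)) c : ip (c *: A) B = c * ip A B.
Proof. by rewrite ipC ipZr ipC. Qed.

Lemma ipNr m n (A B : 'M[R]_(m, n)) : ip A (- B) = - ip A B.
Proof. by rewrite -scaleN1r ipZr mulN1r. Qed.

Lemma ipNl m n (A B : 'M[R]_(m, n)) : ip (- A) B = - ip A B.
Proof. by rewrite ipC ipNr ipC. Qed.

Lemma ip0r m n (A : 'M[R]_(m, n)) : ip A 0 = 0.
Proof. by rewrite -(scale0r A) ipZr mul0r. Qed.

Definition ip_lin := (@ipDl, @ipDr, @ipZl, @ipZr, @ipNl, @ipNr).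

Lemma ip_eq0 m n (A : 'M[R]_(m, n)) : ip A A = 0 -> A = 0.
Proof.
rewrite ipE => /eqP; rewrite psumr_eq0 => [|i _]; last first.
  by apply: sumr_ge0 => j _; rewrite -expr2 sqr_ge0.
move=> /allP h; apply/matrixP => i j; rewrite mxE.
have := h i (mem_index_enum i); rewrite psumr_eq0 => [|k _]; last first.
  by rewrite -expr2 sqr_ge0.
move=> /allP /(_ j (mem_index_enum j)) /=.
by rewrite -expr2 sqrf_eq0 => /eqP.
Qed.

Lemma ip_tr m n (A B : 'M[R]_(m, n)) : ip A^T B^T = ip A B.
Proof. by rewrite /ip trmxK mxtrace_mulC; exact: ipC. Qed.

Lemma ip_mull m n p (S : 'M[R]_(p, m)) (A : 'M[R]_(m, n)) (B : 'M[R]_(p, n)) :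
  ip (S *m A) B = ip A (S^T *m B).
Proof. by rewrite /ip trmx_mul mulmxA. Qed.

Lemma ip_mulr m n p (S : 'M[R]_(n, p)) (A : 'M[R]_(m, n)) (B : 'M[R]_(m, p)) :
  ip (A *m S) B = ip A (B *m S^T).
Proof. by rewrite -ip_tr trmx_mul ip_mull trmxK -ip_tr trmx_mul !trmxK. Qed.

Lemma dotv_ip d (x y : 'cV[R]_d) : dotv x y = ip x y.
Proof. by rewrite /dotv /ip trace_mx11. Qed.

Lemma ip_cols m n (A B : 'M[R]_(m, n)) : ip A B = \sum_j ip (col j A) (col j B).
Proof.
rewrite ipE exchange_big /=; apply: eq_bigr => j _; rewrite ipE.
by apply: eq_bigr => i _; rewrite big_ord1 !mxE.
Qed.

(** Source of both Cauchy-Schwarz inequalities below. Allowing c = 0 covers degenerate vectors: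
    there the polynomial is affine and would take the value -1 if b were nonzero. *)
Lemma quad_disc (a b c : R) : 0 <= c ->
  (forall t, 0 <= a + 2 * b * t + c * t ^+ 2) -> b ^+ 2 <= a * c.
Proof.
rewrite le_eqVlt => /predU1P[<- h|c0 h].
  rewrite mulr0; have [->|b0] := eqVneq b 0; first by rewrite expr0n.
  have := h (- (a + 1) / (2 * b)); rewrite mul0r addr0.
  have -> : a + 2 * b * (- (a + 1) / (2 * b)) = - 1 by field.
  by lra.
have := h (- b / c).
have -> : a + 2 * b * (- b / c) + c * (- b / c) ^+ 2 = a - b ^+ 2 / c.
  by field; rewrite gt_eqF.
by rewrite subr_ge0 ler_pdivrMr.
Qed.

Lemma psd_ip d (A : 'M[R]_d) (x : 'cV[R]_d) : psd A -> 0 <= ip x (A *m x).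
Proof. by case=> _ /(_ x); rewrite dotv_ip. Qed.

Lemma psd_CS d (A : 'M[R]_d) (x y : 'cV[R]_d) : psd A ->
  ip x (A *m y) ^+ 2 <= ip x (A *m x) * ip y (A *m y).
Proof.
move=> pA; apply: quad_disc; first exact: psd_ip.
move=> t; have := psd_ip (x + t *: y) pA; rewrite mulmxDr -scalemxAr !ip_lin.
have -> : ip y (A *m x) = ip x (A *m y).
  by rewrite -{2}(pA.1) -ip_mull ipC.
by rewrite (_ : _ + _ = ip x (A *m x) + 2 * ip x (A *m y) * t +
  ip y (A *m y) * t ^+ 2)//; ring.
Qed.

Lemma ip_CS m n (A B : 'M[R]_(m, n)) : ip A B ^+ 2 <= ip A A * ip B B.
Proof.
apply: quad_disc; first exact: ip_ge0.
move=> t; have := ip_ge0 (A + t *: B); rewrite !ip_lin (ipC B A).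
by rewrite (_ : _ + _ = ip A A + 2 * ip A B * t + ip B B * t ^+ 2)//; ring.
Qed.

End FrobeniusProduct.

(** * Loewner intervals; Lipschitz bounds for inverse, square root and projection *)

Section Between.
Context {R : realType}.

Definition between d (a b : R) (A : 'M[R]_d) :=
  A^T = A /\ forall x : 'cV[R]_d,
    a * ip x x <= ip x (A *m x) /\ ip x (A *m x) <= b * ip x x.

Lemma loewnerP d (A B : 'M[R]_d) : A^T = A -> B^T = B ->
  loewner A B <-> forall x : 'cV[R]_d, ip x (A *m x) <= ip x (B *m x).
Proof.
move=> sA sB; rewrite /loewner /psd /symmetric_mx linearB /= sA sB; split.
  by move=> [_ h] x; have := h x; rewrite dotv_ip mulmxBl ipDr ipNr subr_ge0.
by move=> h; split=> // x; rewrite dotv_ip mulmxBl ipDr ipNr subr_ge0.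
Qed.

Lemma covsetP d (tau zeta : R) (A : 'M[R]_d) :
  covset tau zeta A <-> between zeta^-1 tau^-1 A.
Proof.
rewrite /covset /= /between; split.
  move=> [sA]; rewrite !loewnerP ?tr_scalar_mx// => h1 h2; split=> // x.
  by have := h1 x; have := h2 x; rewrite !mul_scalar_mx !ipZr.
move=> [sA h]; split=> //; rewrite loewnerP ?tr_scalar_mx// => x;
  by have := h x; rewrite !mul_scalar_mx !ipZr => -[].
Qed.

Lemma between_psd d (a b : R) (A : 'M[R]_d) : 0 <= a -> between a b A -> psd A.
Proof.
move=> a0 [sA h]; split=> // x; rewrite dotv_ip.
by apply: le_trans (h x).1; rewrite mulr_ge0// ip_ge0.
Qed.

(* Cauchy-Schwarz for the form of A, applied to x and A x. *)
Lemma psd_sqr_le d (t : R) (A : 'M[R]_d) (x : 'cV[R]_d) : psd A ->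
  (forall x : 'cV[R]_d, ip x (A *m x) <= t * ip x x) ->
  ip (A *m x) (A *m x) <= t * ip x (A *m x).
Proof.
move=> pA h; have := psd_CS (A *m x) x pA; have := h (A *m x).
set y := A *m x; have y0 := ip_ge0 y; have x0 := psd_ip x pA.
rewrite -/y in x0 * => h1 h2.
have [yy0|yy0] := eqVneq (ip y y) 0.
  rewrite yy0; have := h x; rewrite -/y.
  have -> : y = 0 by exact: ip_eq0.
  by rewrite ip0r mulr0.
have yy1 : 0 < ip y y by rewrite lt_neqAle eq_sym yy0.
rewrite -(ler_pM2l yy1) -expr2; apply: (le_trans h2).
by rewrite mulrA [ip y y * t]mulrC ler_wpM2r.
Qed.

Lemma between_unit d (a b : R) (A : 'M[R]_d) : 0 < a -> between a b A ->
  A \in unitmx.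
Proof.
move=> a0 [sA h]; rewrite -row_free_unit; apply: inj_row_free => v vA.
have Av : A *m v^T = 0 by rewrite -sA -trmx_mul vA trmx0.
have := (h v^T).1; rewrite Av ip0r pmulr_rle0// => v0.
apply: trmx_inj; rewrite trmx0; apply: ip_eq0; apply/eqP.
by rewrite eq_le v0 ip_ge0.
Qed.

(** With y = A x the two bounds become <x, A x> >= |A x|^2 / b, which is [psd_sqr_le], and <x, A x>
    <= |A x|^2 / a, which follows from Cauchy-Schwarz and a |x|^2 <= <x, A x>. *)
Lemma between_inv d (a b : R) (A : 'M[R]_d) : 0 < a -> a <= b ->
  between a b A -> between b^-1 a^-1 (invmx A).
Proof.
move=> a0 ab bA; have b0 : 0 < b by exact: lt_le_trans ab.
have uA := between_unit a0 bA; have pA := between_psd (ltW a0) bA.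
case: (bA) => sA h; split; first by rewrite trmx_inv sA.
move=> y; have -> : y = A *m (invmx A *m y) by rewrite mulKVmx.
set x := invmx A *m y; rewrite mulKmx// [ip _ x]ipC; split.
  rewrite ler_pdivrMl//; apply: psd_sqr_le => // z; exact: (h z).2.
rewrite ler_pdivlMl//.
have [x0|x0] := eqVneq (ip x (A *m x)) 0; first by rewrite x0 mulr0 ip_ge0.
have x1 : 0 < ip x (A *m x) by rewrite lt_neqAle eq_sym x0 psd_ip.
rewrite -(ler_pM2r x1) -mulrA -expr2.
apply: (@le_trans _ _ (a * (ip x x * ip (A *m x) (A *m x)))).
  by rewrite ler_pM2l// ip_CS.
by rewrite mulrA mulrC ler_wpM2l// ?ip_ge0//; exact: (h x).1.
Qed.

(** This form of S' makes convexity visible: it is an intersection of linear constraints, whereas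
    the image under inversion hides it. *)
Lemma precsetP d (tau zeta : R) (X : 'M[R]_d) : 0 < tau -> tau <= zeta ->
  precset tau zeta X <-> between tau zeta X.
Proof.
move=> t0 tz; have z0 := lt_le_trans t0 tz; split.
  move=> [S /covsetP bS <-].
  rewrite -[tau]invrK -[zeta]invrK; apply: between_inv => //.
    by rewrite invr_gt0.
  by rewrite lef_pV2.
move=> bX; exists (invmx X); last exact: invmxK.
by apply/covsetP; exact: between_inv.
Qed.

Lemma between_conv d (a b t : R) (A B : 'M[R]_d) : 0 <= t -> t <= 1 ->
  between a b A -> between a b B -> between a b (A + t *: (B - A)).
Proof.
move=> t0 t1 [sA hA] [sB hB]; split.
  by rewrite linearD /= linearZ /= linearB /= sA sB.
move=> x; have [a1 a2] := hA x; have [b1 b2] := hB x.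
rewrite mulmxDl -scalemxAl mulmxBl !ip_lin.
have := ip_ge0 x; set n := ip x x in a1 a2 b1 b2 *.
set p := ip x (A *m x) in a1 a2 *; set q := ip x (B *m x) in b1 b2 *.
by move=> n0; split; nra.
Qed.

Lemma ip_mul_le m n p c (A : 'M[R]_(p, m)) (B : 'M[R]_(m, n)) :
  (forall x : 'cV[R]_m, ip (A *m x) (A *m x) <= c * ip x x) ->
  ip (A *m B) (A *m B) <= c * ip B B.
Proof.
move=> h; rewrite ip_cols (ip_cols B) mulr_sumr; apply: ler_sum => j _.
by rewrite colE -mulmxA -colE; exact: h.
Qed.

Lemma ip_form_ge m n c (A : 'M[R]_m) (B : 'M[R]_(m, n)) :
  (forall x : 'cV[R]_m, c * ip x x <= ip x (A *m x)) ->
  c * ip B B <= ip B (A *m B).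
Proof.
move=> h; rewrite ip_cols [leRHS]ip_cols mulr_sumr; apply: ler_sum => j _.
by rewrite [col j (_ *m _)]colE -mulmxA -colE; exact: h.
Qed.

Lemma between_sqr d (a b : R) (A : 'M[R]_d) (x : 'cV[R]_d) : 0 <= a -> 0 <= b ->
  between a b A -> ip (A *m x) (A *m x) <= b ^+ 2 * ip x x.
Proof.
move=> a0 b0 bA.
have := @psd_sqr_le _ b _ x (between_psd a0 bA) (fun z => (bA.2 z).2).
move=> h; apply: (le_trans h); rewrite expr2 -mulrA ler_wpM2l//.
exact: (bA.2 x).2.
Qed.

(** The resolvent identity A^-1 - B^-1 = A^-1 (B - A) B^-1, each outer factor having operator norm
    at most 1/a. *)
Lemma between_inv_lip d (a b : R) (A B : 'M[R]_d) : 0 < a -> a <= b ->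
  between a b A -> between a b B ->
  ip (invmx A - invmx B) (invmx A - invmx B) <= (a^-1 ^+ 2) ^+ 2 * ip (A - B) (A - B).
Proof.
move=> a0 ab bA bB; have b0 := lt_le_trans a0 ab.
have k0 : 0 <= a^-1 ^+ 2 by exact: sqr_ge0.
have uA := between_unit a0 bA; have uB := between_unit a0 bB.
have iA := between_inv a0 ab bA; have iB := between_inv a0 ab bB.
have i0 x := @between_sqr _ _ _ _ x (ltW (_ : 0 < b^-1)) (ltW (_ : 0 < a^-1)).
have -> : invmx A - invmx B = invmx A *m ((B - A) *m invmx B).
  by rewrite mulmxBl mulmxBr mulmxV// mulmx1 mulKmx.
set k := a^-1 ^+ 2 in k0 i0 *; clearbody k.
apply: (@le_trans _ _ (k * ip ((B - A) *m invmx B) ((B - A) *m invmx B))).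
  by apply: ip_mul_le => x; apply: i0 => //; rewrite invr_gt0.
rewrite expr2 -mulrA ler_wpM2l//.
rewrite -ip_tr trmx_mul trmx_inv (bB.1) -[ip (A - B) _]ip_tr -[A - B]opprB.
rewrite [(- _)^T]linearN /= ipNl ipNr opprK.
by apply: ip_mul_le => x; apply: i0 => //; rewrite invr_gt0.
Qed.

(** Cauchy-Schwarz gives T <= sqrt b, hence a |x|^2 <= |T x|^2 <= sqrt b <x, T x>. The sharp
    constant is sqrt a; any positive one will do, since it only enters a Lipschitz constant. *)
Lemma sqrtm_ge d (a b : R) (A T : 'M[R]_d) (x : 'cV[R]_d) : 0 < a -> 0 < b ->
  between a b A -> is_sqrtm A T ->
  a / Num.sqrt b * ip x x <= ip x (T *m x).
Proof.
move=> a0 b0 [sA h] [pT TT].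
have hT (y : 'cV[R]_d) : ip (T *m y) (T *m y) = ip y (A *m y).
  by rewrite ip_mull (pT.1) mulmxA TT.
have s0 : 0 < Num.sqrt b by rewrite sqrtr_gt0.
have ub (y : 'cV[R]_d) : ip y (T *m y) <= Num.sqrt b * ip y y.
  rewrite -ler_sqr ?nnegrE ?psd_ip ?mulr_ge0 ?ip_ge0 ?sqrtr_ge0//.
  apply: (le_trans (ip_CS _ _)); rewrite hT exprMn sqr_sqrtr; last exact: ltW.
  by rewrite expr2 mulrCA ler_wpM2l ?ip_ge0//; exact: (h y).2.
rewrite mulrAC ler_pdivrMr// mulrC [leRHS]mulrC mulrC; apply: (le_trans (h x).1).
by rewrite -hT; exact: psd_sqr_le.
Qed.

(* With D = T - T', pair D with A - A' = T D + D T', where T, T' >= c. *)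
Lemma sqrtm_lip d (a b : R) (A A' T T' : 'M[R]_d) : 0 < a -> 0 < b ->
  between a b A -> between a b A' -> is_sqrtm A T -> is_sqrtm A' T' ->
  ip (T - T') (T - T') <=
    (2 * (a / Num.sqrt b)) ^- 2 * ip (A - A') (A - A').
Proof.
move=> a0 b0 bA bA' sT sT'; set c := a / Num.sqrt b.
have c0 : 0 < c by rewrite divr_gt0// sqrtr_gt0.
have geT x := sqrtm_ge x a0 b0 bA sT; have geT' x := sqrtm_ge x a0 b0 bA' sT'.
rewrite -/c in geT geT'; clearbody c.
rewrite ler_pdivlMl ?exprn_gt0 ?mulr_gt0//; set D := T - T'.
have sD : D^T = D by rewrite /D linearB /= (sT.1.1) (sT'.1.1).
have e : A - A' = T *m D + D *m T'.
  by rewrite -(sT.2) -(sT'.2) mulmxBl mulmxBr addrA subrK.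
clearbody D.
have h : 2 * c * ip D D <= ip D (A - A').
  rewrite e ipDr (_ : 2 * c * _ = c * ip D D + c * ip D D); last by ring.
  apply: lerD.
    exact: ip_form_ge.
  rewrite -[X in _ <= X]ip_tr trmx_mul sD (sT'.1.1).
  exact: ip_form_ge.
have [D0|D0] := eqVneq (ip D D) 0; first by rewrite D0 mulr0 ip_ge0.
have D1 : 0 < ip D D by rewrite lt_neqAle eq_sym D0 ip_ge0.
rewrite -(ler_pM2l D1); apply: le_trans (ip_CS _ _).
set q := ip D D in h D1 *.
rewrite (_ : q * _ = (2 * c * q) ^+ 2); last by ring.
by rewrite ler_sqr ?nnegrE// ?(le_trans _ h)// !mulr_ge0// ltW.
Qed.

Lemma proj_nonexp d (tau zeta : R) (A A' X X' : 'M[R]_d) :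
  0 < tau -> tau <= zeta ->
  is_proj (precset tau zeta) A X -> is_proj (precset tau zeta) A' X' ->
  ip (X - X') (X - X') <= ip (A - A') (A - A').
Proof.
move=> t0 tz.
(* Variational inequality of the projection, from comparing Y with the points Y + t (Z - Y) of the
   convex set. *)
have vi (B Y Z : 'M[R]_d) : is_proj (precset tau zeta) B Y -> precset tau zeta Z ->
    ip (B - Y) (Z - Y) <= 0.
  move=> [CY hY] CZ; set p := ip _ _; set q := ip (Z - Y) (Z - Y).
  have q0 : 0 <= q by exact: ip_ge0.
  have h t : 0 <= t -> t <= 1 -> 2 * t * p <= t ^+ 2 * q.
    move=> t1 t2; have := hY (Y + t *: (Z - Y)).
    move=> /(_ _); rewrite precsetP// in CY; rewrite precsetP// in CZ.
    rewrite precsetP// => /(_ (between_conv t1 t2 CY CZ)).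
    rewrite frob_le opprD addrA.
    by rewrite !(ipDl (B - Y), ipDr _ (B - Y), ipNr, ipNl, ipZl, ipZr)
      -/q (ipC (Z - Y)) -/p; nra.
  rewrite leNgt; apply/negP => p0.
  have m0 : 0 < p + q by exact: ltr_wpDr.
  (* This t = r lies in (0, 1] and satisfies r q <= p, so 2 p <= r q contradicts p > 0. *)
  have := h (p / (p + q)) (ltW (divr_gt0 p0 m0)).
  rewrite ler_pdivrMr// mul1r lerDl => /(_ q0).
  set r := p / (p + q); have r0 : 0 < r by exact: divr_gt0.
  rewrite (_ : 2 * r * p = r * (2 * p)); last by ring.
  rewrite expr2 -mulrA ler_pM2l// => h2.
  have e : r * (p + q) = p by rewrite divfK// gt_eqF.
  have : 0 <= r * p by rewrite mulr_ge0 ?ltW.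
  by nra.
move=> pA pA'; have h1 := vi _ _ _ pA pA'.1; have h2 := vi _ _ _ pA' pA.1.
(* Sum of the two variational inequalities, each projection tested against the other. *)
have h : ip (X - X') (X - X') <= ip (A - A') (X - X').
  move: h1 h2; rewrite !ip_lin (ipC X' X); lra.
have [D0|D0] := eqVneq (ip (X - X') (X - X')) 0; first by rewrite D0 ip_ge0.
have D1 : 0 < ip (X - X') (X - X') by rewrite lt_neqAle eq_sym D0 ip_ge0.
rewrite -(ler_pM2r D1) -expr2; apply: le_trans (ip_CS _ _).
by rewrite ler_sqr ?nnegrE// ?ltW// (lt_le_trans D1).
Qed.

Lemma sandwich_le d (a : R) (W X B : 'M[R]_d) : 0 <= a -> W^T = W -> W *m W = X ->
  (forall x : 'cV[R]_d, ip x (X *m x) <= a * ip x x) ->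
  ip (W *m B *m W) (W *m B *m W) <= a ^+ 2 * ip B B.
Proof.
move=> a0 sW WW h.
have hW (x : 'cV[R]_d) : ip (W *m x) (W *m x) <= a * ip x x.
  by rewrite ip_mull sW mulmxA WW; exact: h.
rewrite -mulmxA; apply: (le_trans (ip_mul_le _ hW)).
rewrite expr2 -mulrA ler_wpM2l// -ip_tr trmx_mul sW -[ip B B]ip_tr.
exact: ip_mul_le.
Qed.

End Between.

(** * Moments of the normal distribution *)

Section NormalMoments.
Context {R : realType}.
Local Notation leb := (@lebesgue_measure R).
Local Notation pdf := (@normal_pdf R 0 1).
Local Notation N01 := (@normal_prob R 0 1).

(** Uniqueness of densities: it turns the abstract Radon-Nikodym change of variables into
    integration against the explicit Gaussian density. *)
Lemma ae_eq_normal_density :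
  ae_eq leb setT (Radon_Nikodym_SigmaFinite.f N01 leb) (fun x => (pdf x)%:E).
Proof.
have dom := @normal_prob_dominates R 0 1.
apply: integral_ae_eq => //.
- exact: Radon_Nikodym_SigmaFinite.f_integrable.
- by apply/measurable_EFinP; exact: measurable_normal_pdf.
- by move=> E _ mE; rewrite -Radon_Nikodym_SigmaFinite.f_integral.
Qed.

Lemma ge0_integral_normal_prob (h : measurableTypeR R -> \bar R) : (forall x, 0 <= h x)%E ->
  measurable_fun setT h ->
  (\int[N01]_x h x = \int[leb]_x (h x * (pdf x)%:E))%E.
Proof.
move=> h0 mh; have dom := @normal_prob_dominates R 0 1.
rewrite -(Radon_Nikodym_SigmaFinite.change_of_variables dom)//.
apply: ae_eq_integral => //.
- apply: emeasurable_funM => //.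
  exact: measurable_int (Radon_Nikodym_SigmaFinite.f_integrable dom).
- apply: emeasurable_funM => //.
  by apply/measurable_EFinP; exact: measurable_normal_pdf.
- by apply: ae_eqe_mul2l; exact: ae_eq_normal_density.
Qed.

Lemma integral_normal_prob (h : measurableTypeR R -> \bar R) :
  N01.-integrable setT h ->
  (\int[N01]_x h x = \int[leb]_x (h x * (pdf x)%:E))%E.
Proof.
move=> ih; have dom := @normal_prob_dominates R 0 1.
have mh := measurable_int _ ih.
rewrite -(Radon_Nikodym_change_of_variables dom)//.
apply: ae_eq_integral => //.
- by apply: emeasurable_funM.
- apply: emeasurable_funM => //.
  by apply/measurable_EFinP; exact: measurable_normal_pdf.
- apply: ae_eqe_mul2l.
  apply: (ae_eq_trans _ ae_eq_normal_density).
  exact/ae_eq_sym/ae_eq_Radon_Nikodym_SigmaFinite.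
Qed.

Lemma pdfE x : pdf x = normal_peak 1 * expR (- (x ^+ 2 / 2)).
Proof.
by rewrite normal_pdfE ?oner_neq0// /normal_fun subr0 expr1n mulNr.
Qed.

Lemma is_derive_pdf (x : R) : is_derive x 1 pdf (- x * pdf x).
Proof.
have -> : pdf = (fun x => normal_peak 1 * expR (- (x ^+ 2 / 2))).
  by apply/funext => y; exact: pdfE.
apply: is_derive_eq; rewrite /GRing.scale /=.
by field.
Qed.

Lemma normr_exp_le (x : R) n : `|x| ^+ n <= 1 + (x ^+ 2) ^+ n.+1.
Proof.
have [x1|x1] := leP `|x| 1.
  apply: (@le_trans _ _ 1); first by rewrite exprn_ile1.
  by rewrite lerDl exprn_ge0// sqr_ge0.
rewrite -(real_normK (num_real x)) -exprM; apply: ler_wpDl => //.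
by rewrite ler_weXn2l ?ltW// (leq_trans (leqnSn n))// leq_pmull.
Qed.

(** Split exp(-x^2/2) = exp(-3x^2/8) exp(-x^2/8). The first factor absorbs the power of x through
    the series bound on exp; the second is, up to a constant, the density with standard deviation 2,
    whose integrability is known. *)
Lemma pow_pdf_le n : exists C, 0 <= C /\
  forall x, `|x| ^+ n * pdf x <= C * normal_pdf 0 2 x.
Proof.
pose C := 1 + (8 / 3) ^+ n.+1 * n.+1`!%:R : R.
have p1 := @normal_peak_gt0 R 1 (oner_neq0 _).
have p2 : 0 < @normal_peak R 2 by apply: normal_peak_gt0; rewrite pnatr_eq0.
have C0 : 0 <= C by rewrite addr_ge0// mulr_ge0// exprn_ge0// divr_ge0.
exists (normal_peak 1 / normal_peak 2 * C); split.
  by rewrite mulr_ge0// divr_ge0// ltW.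
move=> x; rewrite pdfE normal_pdfE ?pnatr_eq0// /normal_fun subr0.
rewrite (_ : _ / _ * _ * _ =
  normal_peak 1 * (C * expR (- x ^+ 2 / (2 ^+ 2 *+ 2)))); last first.
  by field; rewrite gt_eqF.
rewrite mulrCA ler_pM2l//.
have -> : - (x ^+ 2 / 2) = - (3 / 8 * x ^+ 2) + - x ^+ 2 / (2 ^+ 2 *+ 2).
  by field.
rewrite expRD mulrA ler_pM2r ?expR_gt0// expRN ler_pdivrMr ?expR_gt0//.
set y := 3 / 8 * x ^+ 2; have y0 : 0 <= y by rewrite mulr_ge0// ?sqr_ge0// divr_ge0.
have := expR_ge1Dxn n y0; set e := expR y => he.
have k0 : 0 < (n.+1)`!%:R :> R by rewrite ltr0n fact_gt0.
apply: (le_trans (normr_exp_le x n)); rewrite /C mulrDl mul1r; apply: lerD.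
  by apply: le_trans he; rewrite lerDl divr_ge0 ?exprn_ge0// ltW.
have -> : x ^+ 2 = 8 / 3 * y by rewrite /y; field.
rewrite exprMn -mulrA ler_wpM2l ?exprn_ge0 ?divr_ge0//.
by rewrite mulrC -ler_pdivrMr//; apply: le_trans he; rewrite lerDr.
Qed.

Lemma measurable_pow_pdf n : measurable_fun setT (fun x : measurableTypeR R => x ^+ n * pdf x).
Proof.
apply: measurable_funM; last exact: measurable_normal_pdf.
exact: measurable_funX.
Qed.

Lemma integrable_pow_pdf n :
  leb.-integrable setT (fun x => (x ^+ n * pdf x)%:E).
Proof.
have [C [C0 hC]] := pow_pdf_le n.
apply: (@le_integrable _ _ _ leb setT measurableT _
  (fun x : measurableTypeR R => (C * normal_pdf 0 2 x)%:E)).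
- by apply/measurable_EFinP; exact: measurable_pow_pdf.
- move=> x _; rewrite !abse_EFin lee_fin normrM normrX.
  rewrite (ger0_norm (normal_pdf_ge0 _ _ _)) (le_trans (hC x))// ler_norm//.
- under eq_fun do rewrite EFinM.
  by apply: integrableZl => //; exact: integrable_normal_pdf.
Qed.

(* Integration of (x^n pdf)' over [-k, k], k -> oo. *)
Lemma pow_pdf_stein n :
  (\int[leb]_x (x ^+ n.+1 * pdf x) = n%:R * \int[leb]_x (x ^+ n.-1 * pdf x))%R.
Proof.
(* The derivative of -x^n [pdf]. For n = 0 the truncated exponent [n.-1] is harmless because its
   coefficient vanishes. *)
pose g x := x ^+ n.+1 * pdf x - n%:R * (x ^+ n.-1 * pdf x).
have ig : leb.-integrable setT (EFin \o g).
  rewrite (_ : EFin \o g = (fun x => (x ^+ n.+1 * pdf x)%:E) \-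
    (fun x => n%:R%:E * (x ^+ n.-1 * pdf x)%:E))%E; last first.
    by apply/funext => x; rewrite /g /= EFinB EFinM.
  apply: integrableB => //; first exact: integrable_pow_pdf.
  by apply: integrableZl => //; exact: integrable_pow_pdf.
suff g0 : (\int[leb]_x (g x)%:E = 0)%E.
  have := g0; under eq_integral do rewrite EFinB.
  rewrite integralB_EFin//; last 2 first.
  - exact: integrable_pow_pdf.
  - rewrite (_ : EFin \o _ = (fun x => n%:R%:E * (x ^+ n.-1 * pdf x)%:E)%E).
      by apply: integrableZl => //; exact: integrable_pow_pdf.
    by apply/funext => x; rewrite /= EFinM.
  under [X in (_ - X)%E]eq_integral do rewrite EFinM.
  rewrite integralZl//; last exact: integrable_pow_pdf.
  rewrite /Rintegral.
  have f1 := integrable_fin_num measurableT (integrable_pow_pdf n.+1).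
  have f2 := integrable_fin_num measurableT (integrable_pow_pdf n.-1).
  rewrite -(fineK f1) -(fineK f2) -EFinM -EFinB => -[] /eqP.
  by rewrite subr_eq0 => /eqP.
have dF (x : R) : is_derive x 1 (fun x : R => - (x ^+ n * pdf x)) (g x).
  have dp := is_derive_pdf x.
  rewrite (_ : (fun _ => _) = - ((@id R : R -> R) ^+ n * pdf)); last first.
    by apply/funext => y; rewrite !fctE.
  apply: (is_derive_eq (is_deriveN
    (is_deriveM (is_deriveX n (is_derive_id x (1 : R))) dp))).
  rewrite exprfctE /g /GRing.scale /= exprS; ring.
have cp : continuous (pdf : R -> R) by apply: continuous_normal_pdf; exact: oner_neq0.
have cg : continuous g.
  move=> x; apply: cvgB; [apply: cvgM|apply: cvgM; [exact: cvg_cst|apply: cvgM]];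
    by [exact: cp|exact: exprn_continuous].
have cF : continuous (fun x : R => - (x ^+ n * pdf x)).
  by move=> x; apply: cvgN; apply: cvgM; [exact: exprn_continuous|exact: cp].
have FTC k : (\int[leb]_(x in `[(- k.+1%:R)%R, k.+1%:R]) (g x)%:E =
    (- (k.+1%:R ^+ n * pdf k.+1%:R) + (- k.+1%:R) ^+ n * pdf (- k.+1%:R))%:E)%E.
  rewrite (@continuous_FTC2 _ g (fun x : R => - (x ^+ n * pdf x))).
  - by rewrite -EFinB opprK.
  - by rewrite (@lt_trans _ _ 0)// ?oppr_lt0 ?ltr0n.
  - exact: continuous_subspaceT.
  - split.
    + by move=> x _; have [] := dF x.
    + by apply: cvg_at_right_filter; exact: cF.
    + by apply: cvg_at_left_filter; exact: cF.
  - by move=> x _; rewrite derive1E; exact: derive_val.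
have [C [C0 hC]] := pow_pdf_le n.+1.
pose K := C * normal_peak 2.
(* One spare power of x in [pow_pdf_le] makes the boundary terms O(1/k). *)
have bF x : 0 < `|x| -> `|x ^+ n * pdf x| <= K / `|x|.
  move=> x0; rewrite ler_pdivlMr// normrM normrX mulrC mulrA -exprS.
  rewrite (ger0_norm (normal_pdf_ge0 _ _ _)) (le_trans (hC x))//.
  by rewrite ler_wpM2l// normal_pdf_ub// pnatr_eq0.
(* The integrals of these truncations have two limits: the integral of g by dominated convergence,
   and 0 by the boundary terms. *)
pose fk k x := (g x * \1_(`[(- k.+1%:R)%R, k.+1%:R]) x)%:E.
have ek k : (\int[leb]_x fk k x =
    \int[leb]_(x in `[(- k.+1%:R)%R, k.+1%:R]) (g x)%:E)%E.
  rewrite [RHS]integral_mkcond; apply: eq_integral => x _.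
  rewrite /fk patchE indicE; case: ifP => /= _; first by rewrite mulr1.
  by rewrite mulr0.
have c1 : (fun k => \int[leb]_x fk k x)%E @ \oo --> (\int[leb]_x (g x)%:E)%E.
  have [] := @dominated_convergence _ _ _ leb setT measurableT fk
    (EFin \o g) (abse \o (EFin \o g)).
  - move=> k; apply/measurable_EFinP; apply: measurable_funM => //.
    by apply: continuous_measurable_fun.
  - by apply: (measurable_int leb).
  - apply: aeW => x _; apply: cvg_near_cst.
    near=> k; rewrite /fk indicE mem_set ?mulr1//=.
    rewrite in_itv /= -ler_norml.
    near: k; exists (Num.trunc `|x|).+1 => // k /= hk.
    rewrite (le_trans (ltW (truncnS_gt `|x|)))// ler_nat.
    exact: leq_trans hk _.
  - exact: integrable_abse.
  - apply: aeW => x k _; rewrite /fk /= lee_fin normrM ler_piMr//.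
    by rewrite indicE; case: (_ \in _); rewrite ?normr1 ?normr0.
  by [].
have c2 : (fun k => \int[leb]_x fk k x)%E @ \oo --> 0%E.
  under eq_fun do rewrite ek FTC.
  apply: cvg_EFin; first exact: nearW.
  apply/norm_cvg0P.
  apply: (@squeeze_cvgr _ _ _ _ (cst 0) (fun k => 2 * K * k.+1%:R^-1)).
  - near=> k; rewrite normr_ge0 /= (le_trans (ler_normD _ _))//.
    have h (s : R) : `|s| = k.+1%:R -> `|s ^+ n * pdf s| <= K / k.+1%:R.
      by move=> hs; rewrite -hs bF// hs ltr0n.
    rewrite normrN -mulrA mulr_natl mulr2n; apply: lerD; apply: h.
      by rewrite ger0_norm.
    by rewrite normrN ger0_norm.
  - exact: cvg_cst.
  - rewrite -(mulr0 (2 * K)); apply: cvgMr.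
    exact: cvg_harmonic.
exact: (cvg_unique _ c1 c2).
Unshelve. all: by end_near.
Qed.

End NormalMoments.

(** * Random variables with finite moments *)

Section Moments.
Context {R : realType} {dsp : measure_display} {T : measurableType dsp}.
Variable P : probability T R.
Implicit Types X Y : T -> R.

(* Asking for all moments makes the class closed under products. *)
Definition allmom X := measurable_fun setT X /\
  forall n, P.-integrable setT (fun w => (X w ^+ n)%:E).

Definition expect X : R := (\int[P]_w X w)%R.

Lemma allmom_int X : allmom X -> P.-integrable setT (EFin \o X).
Proof. by move=> [_ /(_ 1%N)]. Qed.

Lemma allmom_le X (g : T -> R) : measurable_fun setT X ->
  (forall n, exists2 h : T -> R, P.-integrable setT (EFin \o h) &
     forall w, `|X w| ^+ n <= h w) -> allmom X.
Proof.
move=> mX hX; split=> // n; have [h ih hh] := hX n.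
apply: (le_integrable _ _ _ ih) => //.
  by apply/measurable_EFinP; exact: measurable_funX.
move=> w _; rewrite !abse_EFin lee_fin normrX.
exact: le_trans (hh w) (ler_norm _).
Qed.

Lemma allmom_abs X n : allmom X ->
  P.-integrable setT (EFin \o (fun w => `|X w| ^+ n)).
Proof.
move=> [_ /(_ n)] /integrable_abse; apply: eq_integrable => // w _.
by rewrite /= normrX.
Qed.

Lemma integrable_add X Y : P.-integrable setT (EFin \o X) ->
  P.-integrable setT (EFin \o Y) ->
  P.-integrable setT (EFin \o (fun w => X w + Y w)).
Proof.
move=> iX iY; have := integrableD measurableT iX iY.
by apply: eq_integrable => // w _; rewrite /= EFinD.
Qed.

Lemma integrable_mull X c : P.-integrable setT (EFin \o X) ->
  P.-integrable setT (EFin \o (fun w => c * X w)).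
Proof.
move=> iX; have := integrableZl measurableT c iX.
by apply: eq_integrable => // w _; rewrite /= EFinM.
Qed.

Lemma allmomM X Y : allmom X -> allmom Y -> allmom (fun w => X w * Y w).
Proof.
move=> aX aY; apply: allmom_le => //.
  by apply: measurable_funM; [exact: aX.1|exact: aY.1].
move=> n; exists (fun w => `|X w| ^+ (n * 2) + `|Y w| ^+ (n * 2)).
  by apply: integrable_add; exact: allmom_abs.
move=> w; rewrite normrM exprMn !exprM.
set a := _ ^+ n; set b := _ ^+ n.
have a0 : 0 <= a by exact: exprn_ge0.
have b0 : 0 <= b by exact: exprn_ge0.
nra.
Qed.

Lemma allmomD X Y : allmom X -> allmom Y -> allmom (fun w => X w + Y w).
Proof.
move=> aX aY; apply: allmom_le => //.
  by apply: measurable_funD; [exact: aX.1|exact: aY.1].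
move=> n; exists (fun w => 2 ^+ n * (`|X w| ^+ n + `|Y w| ^+ n)).
  by apply: integrable_mull; apply: integrable_add; exact: allmom_abs.
move=> w; have h (x y : R) : `|x| <= `|y| -> `|x + y| ^+ n <= 2 ^+ n * (`|x| ^+ n + `|y| ^+ n).
  move=> xy; apply: (@le_trans _ _ (2 ^+ n * `|y| ^+ n)).
    rewrite -exprMn lerXn2r ?nnegrE ?mulr_ge0//.
    by rewrite (le_trans (ler_normD _ _))// mulr_natl mulr2n lerD2r.
  by rewrite ler_wpM2l ?exprn_ge0// lerDr exprn_ge0.
have [xy|yx] := leP `|X w| `|Y w|; first exact: h.
by rewrite addrC [X in _ * X]addrC; apply: h; exact: ltW.
Qed.

Lemma allmom_bounded X (c : R) : measurable_fun setT X ->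
  (forall w, `|X w| <= c) -> allmom X.
Proof.
move=> mX hX; apply: allmom_le => // n; exists (cst (c ^+ n)).
  exact: finite_measure_integrable_cst.
by move=> w; rewrite lerXn2r ?nnegrE// (le_trans _ (hX w)).
Qed.

Lemma allmom_cst c : allmom (cst c).
Proof. exact: (@allmom_bounded _ `|c|). Qed.

Lemma allmomZ X c : allmom X -> allmom (fun w => c * X w).
Proof. by move=> aX; apply: allmomM => //; exact: allmom_cst. Qed.

Lemma allmomB X Y : allmom X -> allmom Y -> allmom (fun w => X w - Y w).
Proof.
move=> aX aY; rewrite (_ : (fun _ => _) = fun w => X w + -1 * Y w).
  by apply: allmomD => //; exact: allmomZ.
by apply/funext => w; rewrite mulN1r.
Qed.

Lemma allmomX X n : allmom X -> allmom (fun w => X w ^+ n).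
Proof.
move=> aX; elim: n => [|n IHn]; first exact: allmom_cst.
rewrite (_ : (fun _ => _) = fun w => X w * X w ^+ n); first exact: allmomM.
by apply/funext => w; rewrite exprS.
Qed.

Lemma allmom_sum I (s : seq I) (X : I -> T -> R) :
  (forall i, allmom (X i)) -> allmom (fun w => \sum_(i <- s) X i w).
Proof.
move=> aX; elim: s => [|i s IHs].
  rewrite (_ : (fun _ => _) = cst 0); first exact: allmom_cst.
  by apply/funext => w; rewrite big_nil.
rewrite (_ : (fun _ => _) = fun w => X i w + \sum_(j <- s) X j w).
  exact: allmomD.
by apply/funext => w; rewrite big_cons.
Qed.

Lemma allmom_prod I (s : seq I) (p : pred I) (X : I -> T -> R) :
  (forall i, allmom (X i)) -> allmom (fun w => \prod_(i <- s | p i) X i w).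
Proof.
move=> aX; elim: s => [|i s IHs].
  rewrite (_ : (fun _ => _) = cst 1); first exact: allmom_cst.
  by apply/funext => w; rewrite big_nil.
under eq_fun do rewrite big_cons.
by case: (p i) => //; exact: allmomM.
Qed.

Lemma expectD X Y : allmom X -> allmom Y -> expect (fun w => X w + Y w) = expect X + expect Y.
Proof. by move=> aX aY; apply: RintegralD => //; exact: allmom_int. Qed.

Lemma expectZ X c : allmom X -> expect (fun w => c * X w) = c * expect X.
Proof. by move=> aX; apply: RintegralZl => //; exact: allmom_int. Qed.

Lemma expect_cst c : expect (cst c) = c.
Proof.
by rewrite /expect Rintegral_cst//= probability_setT mulr1.
Qed.

Lemma expectB X Y : allmom X -> allmom Y -> expect (fun w => X w - Y w) = expect X - expect Y.
Proof. by move=> aX aY; apply: RintegralB => //; exact: allmom_int. Qed.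

Lemma expect_le X Y : allmom X -> allmom Y -> (forall w, X w <= Y w) -> expect X <= expect Y.
Proof. by move=> aX aY h; apply: le_Rintegral => //; exact: allmom_int. Qed.

Lemma expect_sum I (s : seq I) (X : I -> T -> R) : (forall i, allmom (X i)) ->
  expect (fun w => \sum_(i <- s) X i w) = \sum_(i <- s) expect (X i).
Proof.
move=> aX; elim: s => [|i s IHs].
  rewrite big_nil -[RHS](expect_cst 0); congr expect.
  by apply/funext => w; rewrite big_nil.
rewrite big_cons -IHs -expectD//; last exact: allmom_sum.
by congr expect; apply/funext => w; rewrite big_cons.
Qed.

Lemma expect_expectation X : allmom X -> ('E_P[X])%E = (expect X)%:E.
Proof.
move=> aX; rewrite unlock /expect /Rintegral fineK//.
exact: integrable_fin_num (allmom_int aX).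
Qed.

(** The factorization on rectangles identifies the law of (X, Y) with the product of the two laws;
    Fubini does the rest. *)
Lemma expect_indep X Y : allmom X -> allmom Y ->
  (forall A B : set R, measurable A -> measurable B ->
     P (X @^-1` A `&` Y @^-1` B) = (P (X @^-1` A) * P (Y @^-1` B))%E) ->
  expect (fun w => X w * Y w) = expect X * expect Y.
Proof.
move=> aX aY ind.
have mX : measurable_fun setT X := aX.1; have mY : measurable_fun setT Y := aY.1.
pose X' : {RV P >-> R} := mfun_Sub (mem_set mX).
pose Y' : {RV P >-> R} := mfun_Sub (mem_set mY).
pose XY w := (X w, Y w).
have mXY : measurable_fun setT XY by exact: measurable_fun_pair.
pose XY' : {RV P >-> (R * R)%type} := mfun_Sub (mem_set mXY).
pose f (z : R * R) : \bar R := (z.1 * z.2)%:E.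
have mf : measurable_fun setT f.
  by apply/measurable_EFinP; apply: measurable_funM.
have prodE A : measurable A ->
    (distribution P X' \x distribution P Y')%E A = distribution P XY' A.
  apply: product_measure_unique => B C mB mC.
  by rewrite /distribution /pushforward /= -ind.
have iXY := allmom_int (allmomM aX aY).
have ifd : (distribution P XY').-integrable setT f.
  exact: integrable_pushforward.
have ifp : (distribution P X' \x distribution P Y')%E.-integrable setT f.
  case/integrableP : ifd => _ ifd; apply/integrableP; split=> //.
  by rewrite (eq_measure_integral (distribution P XY'))// => A mA _; exact: prodE.
have e1 : (\int[P]_w (X w * Y w)%:E =
    \int[distribution P X']_x \int[distribution P Y']_y (x * y)%:E)%E.
  have -> := integral12_prod_meas1 ifp.
  rewrite (eq_measure_integral (distribution P XY')) => [|A mA _]; last first.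
    exact: prodE.
  by rewrite integral_pushforward.
have idX : (distribution P X').-integrable setT (EFin \o @id R).
  by apply: integrable_pushforward => //; [exact/measurable_EFinP|exact: allmom_int].
have idY : (distribution P Y').-integrable setT (EFin \o @id R).
  by apply: integrable_pushforward => //; [exact/measurable_EFinP|exact: allmom_int].
have eX : (\int[distribution P X']_x x%:E = \int[P]_w (X w)%:E)%E.
  by rewrite integral_pushforward//; exact: allmom_int.
have eY : (\int[distribution P Y']_x x%:E = \int[P]_w (Y w)%:E)%E.
  by rewrite integral_pushforward//; exact: allmom_int.
rewrite /expect /Rintegral e1.
have fX := integrable_fin_num measurableT (allmom_int aX).
have fY := integrable_fin_num measurableT (allmom_int aY).
rewrite -fineM// -eX -eY; congr fine.
transitivity (\int[distribution P X']_x (x%:E * \int[distribution P Y']_y y%:E))%E.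
  apply: eq_integral => x _.
  by under eq_integral do rewrite EFinM; rewrite integralZl.
by rewrite eY -(fineK fY) integralZr.
Qed.

End Moments.

(** * Gaussian vectors *)

Lemma measurable_prod_fun (R : realType) d' (T' : measurableType d') I (s : seq I) (p : pred I)
    (f : I -> T' -> R) : (forall i, p i -> measurable_fun setT (f i)) ->
  measurable_fun setT (fun w => \prod_(i <- s | p i) f i w).
Proof.
move=> mf; elim: s => [|i s IHs].
  by under eq_fun do rewrite big_nil; exact: measurable_cst.
under eq_fun do rewrite big_cons.
case pi : (p i) => //; apply: measurable_funM => //; exact: mf.
Qed.

Section Gaussian.
Context {R : realType} {dsp : measure_display} {T : measurableType dsp}.
Variable P : probability T R.
Context {d : nat}.
Variables (v : T -> 'cV[R]_d) (hv : std_gaussian P v).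
Local Notation X := (coords v).
Local Notation expect := (expect P).
Local Notation allmom := (allmom P).
Local Notation leb := (@lebesgue_measure R).
Local Notation pdf := (@normal_pdf R 0 1).
Local Notation N01 := (@normal_prob R 0 1).

Lemma gauss_law i (A : set R) : measurable A -> P (X i @^-1` A) = N01 A.
Proof.
move=> mA; pose C j : set R := if j == i then A else setT.
have mC j : measurable (C j) by rewrite /C; case: ifP.
have -> : X i @^-1` A = \bigcap_j (X j @^-1` C j).
  apply/seteqP; split=> w /= h; last by have := h i I; rewrite /C eqxx.
  by move=> j _; rewrite /C /=; case: eqP => [->|].
rewrite hv.2// (bigD1 i)//= /C eqxx big1 ?mule1// => j /negPf ->.
exact: probability_setT.
Qed.

Lemma gauss_pow_integrable n : N01.-integrable setT (fun x : R => (x ^+ n)%:E).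
Proof.
apply/integrableP; split.
  by apply/measurable_EFinP; exact: measurable_funX.
rewrite ge0_integral_normal_prob//; last first.
  by apply: measurableT_comp => //; apply/measurable_EFinP; exact: measurable_funX.
have /integrableP[_] := @integrable_pow_pdf R n.
apply: le_lt_trans; rewrite le_eqVlt; apply/orP; left; apply/eqP.
apply: eq_integral => x _.
by rewrite !abse_EFin -EFinM normrM (ger0_norm (normal_pdf_ge0 _ _ _)).
Qed.

Lemma gauss_moment i n : P.-integrable setT (fun w => (X i w ^+ n)%:E) /\
  expect (fun w => X i w ^+ n) = (\int[leb]_x (x ^+ n * pdf x))%R.
Proof.
have mX : @measurable_fun _ _ T (measurableTypeR R) setT (X i) := hv.1 i.
pose X' : {mfun T >-> measurableTypeR R} :=
  @mfun_Sub _ _ T (measurableTypeR R) (X i) (mem_set mX).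
pose m : {measure set (measurableTypeR R) -> \bar R} :=
  @distribution _ _ T (measurableTypeR R) R P X'.
have eP (A : set (measurableTypeR R)) : measurable A -> m A = N01 A.
  by move=> mA; rewrite -(gauss_law i mA).
have mp : measurable_fun setT (fun x : measurableTypeR R => (x ^+ n)%:E).
  by apply/measurable_EFinP; exact: measurable_funX.
have iP : P.-integrable setT (fun w => (X i w ^+ n)%:E).
  apply/integrableP; split.
    by apply/measurable_EFinP; apply: measurable_funX; exact: hv.1.
  have /integrableP[_] := gauss_pow_integrable n; apply: le_lt_trans.
  rewrite -(@eq_measure_integral _ _ _ setT N01 m) => [|A mA _]; last exact: eP.
  by rewrite (ge0_integral_pushforward mX)//; exact: measurableT_comp.
split=> //; rewrite /expect  /Rintegral; congr fine.
rewrite -(integral_normal_prob (gauss_pow_integrable n)).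
rewrite -(@eq_measure_integral _ _ _ setT N01 m) => [|A mA _]; last exact: eP.
by rewrite (integral_pushforward mX).
Qed.

Lemma allmom_coord i : allmom (X i).
Proof. by split=> [|n]; [exact: hv.1|have [] := gauss_moment i n]. Qed.

Lemma gauss_moment_rec i n :
  expect (fun w => X i w ^+ n.+1) = n%:R * expect (fun w => X i w ^+ n.-1).
Proof. by rewrite !(gauss_moment i _).2 pow_pdf_stein. Qed.

(** A pi-system generating the events that depend only on the coordinates other than i. *)
Definition boxes (i : 'I_d) : set (set T) := [set S | exists C : 'I_d -> set R,
  [/\ forall j, measurable (C j), C i = setT & S = \bigcap_j (X j @^-1` C j)]].

Lemma boxes_measurable i : boxes i `<=` measurable.
Proof.
move=> _ [C [mC _ ->]]; apply: fin_bigcap_measurable => // j _.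
by rewrite -[X in measurable X]setTI; exact: hv.1.
Qed.

(** Only the measure of boxes is given. For fixed A both sides are finite measures in B that agree
    on the pi-system [boxes i], hence on the sigma-algebra it generates. *)
Lemma gauss_indep i (A : set R) (B : set T) : measurable A ->
  <<s boxes i >> B -> P (X i @^-1` A `&` B) = (P (X i @^-1` A) * P B)%E.
Proof.
move=> mA.
have mA' : measurable (X i @^-1` A) by rewrite -[X in measurable X]setTI; exact: hv.1.
pose r : {nonneg R} := NngNum (fine_ge0 (measure_ge0 P (X i @^-1` A))).
have rE : r%:num%:E = P (X i @^-1` A) by rewrite /= fineK// fin_num_measure.
move=> hB; rewrite setIC -rE.
pose m1 : {measure set T -> \bar R} := mrestr P mA'.
pose m2 : {measure set T -> \bar R} := mscale r P.
rewrite -[LHS]/(m1 B) -[RHS]/(m2 B).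
apply: (@g_sigma_algebra_measure_unique _ _ _ (boxes i) _ (fun=> setT)) => //.
- exact: boxes_measurable.
- move=> _; exists (fun=> setT); split=> //.
  by apply/esym; rewrite -subTset => w _ j _.
- by rewrite bigcup_const.
- move=> _ _ [C [mC Ci ->]] [D [mD Di ->]].
  exists (fun j => C j `&` D j); split=> [j||]; first exact: measurableI.
    by rewrite Ci Di setTI.
  by rewrite -bigcapI; apply: eq_bigcapr => j _; rewrite preimage_setI.
- move=> _ [C [mC Ci ->]].
  transitivity (P (\bigcap_j (X j @^-1` C j) `&` X i @^-1` A)) => //.
  transitivity (r%:num%:E * P (\bigcap_j (X j @^-1` C j)))%E => //; rewrite rE.
  (* Side i of the box is full, so intersecting with the event on X_i merely replaces that side by
     A, and the product formula applies. *)
  pose C' j := if j == i then A else C j.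
  have mC' j : measurable (C' j) by rewrite /C'; case: ifP.
  have -> : \bigcap_j (X j @^-1` C j) `&` X i @^-1` A = \bigcap_j (X j @^-1` C' j).
    apply/seteqP; split=> w /=.
      by move=> [h hA] j _; rewrite /C' /=; case: eqP => [->//|_]; exact: h.
    move=> h; split; last by have := h i I; rewrite /C' eqxx.
    move=> j _; have [->|ji] := eqVneq j i; first by rewrite Ci.
    by have := h j I; rewrite /C' (negPf ji).
  rewrite !hv.2// gauss_law// (bigD1 i)//= [in RHS](bigD1 i)//= Ci.
  rewrite [N01 setT]probability_setT mul1e /C' eqxx; congr (_ * _)%E.
  by apply: eq_bigr => j /negPf ->.
- move=> _; rewrite -[m1 _]/(P (setT `&` X i @^-1` A)) setTI.
  by apply: le_lt_trans (probability_le1 _ _) _; rewrite ?ltry.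
Qed.

Lemma gauss_mono_split i a (e : 'I_d -> nat) :
  expect (fun w => X i w ^+ a * \prod_(j < d | j != i) X j w ^+ e j) =
  expect (fun w => X i w ^+ a) * expect (fun w => \prod_(j < d | j != i) X j w ^+ e j).
Proof.
apply: expect_indep.
- by apply: allmomX; exact: allmom_coord.
- by apply: allmom_prod => j; apply: allmomX; exact: allmom_coord.
move=> A B mA mB.
have -> : (fun w => X i w ^+ a) @^-1` A = X i @^-1` ((fun x => x ^+ a) @^-1` A).
  by [].
apply: gauss_indep.
  by rewrite -[X in measurable X]setTI; apply: measurable_funX.
pose Tb : measurableType _ := g_sigma_algebraType (boxes i).
have mXj j : j != i -> measurable_fun setT (X j : Tb -> R).
  move=> ji _ C mC; rewrite setTI; apply: sub_sigma_algebra.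
  exists (fun k => if k == j then C else setT); split.
  - by move=> k; case: ifP.
  - by rewrite eq_sym (negPf ji).
  - apply/seteqP; split=> w /= h; last by have := h j I; rewrite eqxx.
    by move=> k _; case: eqP => [->|].
have : measurable_fun setT
    ((fun w => \prod_(j < d | j != i) X j w ^+ e j) : Tb -> R).
  by apply: measurable_prod_fun => j ji; apply: measurable_funX; exact: mXj.
by move=> /(_ measurableT B mB); rewrite setTI.
Qed.

(** The factor X_i is independent of the others, which reduces the claim to the moment recursion in
    one variable. If m i = 0, the truncated exponent is multiplied by 0. *)
Lemma gauss_stein_mono i (m : multinom d) :
  expect (fun w => X i w * \prod_(j < d) X j w ^+ m j) =
  (m i)%:R * expect (fun w => \prod_(j < d) X j w ^+ mnm_sub m (mnm1 i) j).
Proof.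
pose g w := \prod_(j < d | j != i) X j w ^+ m j.
have -> : (fun w => X i w * \prod_(j < d) X j w ^+ m j) =
    (fun w => X i w ^+ (m i).+1 * g w).
  by apply/funext => w; rewrite (bigD1 i)//= mulrA -exprS.
have -> : (fun w => \prod_(j < d) X j w ^+ mnm_sub m (mnm1 i) j) =
    (fun w => X i w ^+ (m i).-1 * g w).
  apply/funext => w; rewrite (bigD1 i)//= mnmBE mnm1E eqxx subn1; congr (_ * _).
  by apply: eq_bigr => j ji; rewrite mnmBE mnm1E eq_sym (negPf ji) subn0.
by rewrite !gauss_mono_split gauss_moment_rec mulrA.
Qed.

Lemma allmom_meval (p : mpoly d R) : allmom (fun w => meval (X ^~ w) p).
Proof.
elim/mpolyind: p => [|c m p _ _ IHp].
  by under eq_fun do rewrite meval0; exact: allmom_cst.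
under eq_fun do rewrite mevalD mevalZ mevalX.
apply: allmomD => //; apply: allmomZ; apply: allmom_prod => j.
by apply: allmomX; exact: allmom_coord.
Qed.

(** Gaussian integration by parts, by linearity from monomials. With formal polynomials the
    derivative is algebraic, so no smoothness or growth condition arises. *)
Lemma gauss_stein i (p : mpoly d R) :
  expect (fun w => X i w * meval (X ^~ w) p) = expect (fun w => meval (X ^~ w) (mderiv i p)).
Proof.
elim/mpolyind: p => [|c m p _ _ IHp].
  rewrite linear0; congr expect; apply/funext => w.
  by rewrite meval0 mulr0.
have aX := allmom_coord.
have am (n : multinom d) : allmom (fun w => \prod_(j < d) X j w ^+ n j).
  by apply: allmom_prod => j; apply: allmomX.
have -> : (fun w => X i w * meval (X ^~ w) (c *: mpolyX R m + p)) =
    (fun w => c * (X i w * \prod_(j < d) X j w ^+ m j) + X i w * meval (X ^~ w) p).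
  by apply/funext => w; rewrite mevalD mevalZ mevalX; ring.
have -> : (fun w => meval (X ^~ w) (mderiv i (c *: mpolyX R m + p))) =
    (fun w => c * ((m i)%:R * \prod_(j < d) X j w ^+ mnm_sub m (mnm1 i) j)
       + meval (X ^~ w) (mderiv i p)).
  by apply/funext => w; rewrite mderivD mderivZ mderivX mevalD !mevalZ mevalX.
rewrite !expectD ?expectZ ?IHp ?gauss_stein_mono//.
- exact: allmomZ.
- exact: allmomM.
- by do 2 apply: allmomZ.
- exact: allmom_meval.
- by apply: allmomZ; exact: allmomM.
- by apply: allmomM => //; exact: allmom_meval.
Qed.

End Gaussian.

(** * Moments of Gaussian quadratic forms *)

Section GaussianPolynomials.
Context {R : realType} {dsp : measure_display} {T : measurableType dsp}.
Variable P : probability T R.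
Context {d : nat}.
Variables (v : T -> 'cV[R]_d) (hv : std_gaussian P v).
Local Notation X := (coords v).
Local Notation expect := (expect P).
Local Notation allmom := (allmom P).
Local Notation XX i := (mpolyX R (@mnm1 d i)).

Lemma mderivXU (i j : 'I_d) : mderiv i (XX j) = (i == j)%:R *: (1 : mpoly d R).
Proof.
rewrite mderivX mnm1E eq_sym; case: eqP => [->|_]; last by rewrite !scale0r.
congr (_ *: _); rewrite -[RHS]mpolyX0; congr (mpolyX _ _).
by apply/mnmP => k; rewrite mnmBE mnm0E subnn.
Qed.

Lemma mderivXn (i : 'I_d) (p : mpoly d R) n :
  mderiv i (p ^+ n) = n%:R *: (p ^+ n.-1 * mderiv i p).
Proof.
elim: n => [|n IHn]; first by rewrite expr0 scale0r -mpolyC1 mderivC.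
rewrite exprS mderivM IHn -scalerAr mulrA; case: n {IHn} => [|n] /=.
  by rewrite scale0r addr0 expr0 mulr1 mul1r scale1r.
rewrite -exprS mulrC -[X in X + _]scale1r -scalerDl; congr (_ *: _).
Qed.

Lemma gauss_cov i j : expect (fun w => X i w * X j w) = (i == j)%:R.
Proof.
have := gauss_stein hv i (XX j); rewrite mderivXU.
under eq_fun do rewrite mevalXU.
by under [X in _ = expect X]eq_fun do rewrite mevalZ meval1 mulr1; rewrite expect_cst.
Qed.

(** Isserlis' formula with three pairings; subtracting the covariance of X_k and X_l removes the
    pairing (ij)(kl). *)
Lemma gauss_fourth i j k l :
  expect (fun w => X i w * X j w * (X k w * X l w - (k == l)%:R)) =
  (i == k)%:R * (j == l)%:R + (i == l)%:R * (j == k)%:R.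
Proof.
have aX := allmom_coord hv.
have := gauss_stein hv i (XX j * (XX k * XX l - (k == l)%:R *: 1)).
rewrite mderivM mderivB mderivZ -mpolyC1 mderivC scaler0 subr0 mderivM !mderivXU.
under eq_fun do rewrite mevalM mevalB mevalM mevalZ mevalC !mevalXU mulr1 mulrA.
move=> ->.
under eq_fun do rewrite !(mevalD, mevalN, mevalM, mevalZ, mevalC, meval1, mevalXU)
  !mulr1.
rewrite (_ : (fun _ => _) = fun w =>
    (i == j)%:R * (X k w * X l w - cst (k == l)%:R w) +
    ((i == k)%:R * (X j w * X l w) + (i == l)%:R * (X j w * X k w))); last first.
  by apply/funext => w; rewrite /cst; ring.
have aXX a b : allmom (fun w => X a w * X b w) by exact: allmomM.
have ac c : allmom (cst c) by exact: allmom_cst.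
rewrite expectD ?expectD ?expectZ ?expectB ?gauss_cov ?expect_cst//.
- by rewrite subrr mulr0 add0r.
- exact: allmomB.
- exact: allmomZ.
- exact: allmomZ.
- by apply: allmomZ; exact: allmomB.
- by apply: allmomD; exact: allmomZ.
Qed.

(** Write s^(n+1) as the sum of X_i (X_i s^n) and integrate by parts: differentiating X_i gives d
    s^n in total, differentiating s^n gives 2 n s^n. *)
Lemma gauss_norm_rec n :
  expect (fun w => (\sum_i X i w ^+ 2) ^+ n.+1) =
  (d%:R + 2 * n%:R) * expect (fun w => (\sum_i X i w ^+ 2) ^+ n).
Proof.
pose q : mpoly d R := \sum_i XX i * XX i.
have qE w : meval (X ^~ w) q = \sum_i X i w ^+ 2.
  by rewrite /q rmorph_sum /=; apply: eq_bigr => i _; rewrite mevalM mevalXU.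
have qnE w k : meval (X ^~ w) (q ^+ k) = (\sum_i X i w ^+ 2) ^+ k.
  by rewrite rmorphXn /= qE.
have dq i : mderiv i q = 2 *: XX i.
  rewrite /q linear_sum /= (bigD1 i)//= big1 => [|j ji].
    by rewrite addr0 mderivM mderivXU eqxx !scale1r mul1r mulr1 scaler_nat mulr2n.
  by rewrite mderivM mderivXU eq_sym (negPf ji) scale0r mul0r mulr0 addr0.
have am p := allmom_meval hv p.
have -> : (fun w => (\sum_i X i w ^+ 2) ^+ n.+1) =
    (fun w => \sum_i X i w * meval (X ^~ w) (XX i * q ^+ n)).
  apply/funext => w; rewrite exprS mulr_suml; apply: eq_bigr => i _.
  by rewrite mevalM mevalXU qnE expr2 mulrA.
rewrite expect_sum => [|i]; last by apply: allmomM; [exact: allmom_coord|exact: am].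
under eq_bigr do rewrite gauss_stein//.
rewrite -expect_sum => [|i]; last exact: am.
rewrite -expectZ; last first.
  by under eq_fun do rewrite -qnE; exact: am.
congr expect; apply/funext => w.
under eq_bigr => i _.
  rewrite mderivM mderivXU eqxx scale1r mul1r mderivXn dq mevalD qnE mevalM mevalZ.
  rewrite mevalM mevalZ qnE mevalXU.
  rewrite (_ : X i w * _ = 2 * n%:R * (\sum_i X i w ^+ 2) ^+ n.-1 * X i w ^+ 2);
    last by ring.
  over.
rewrite big_split /= sumr_const card_ord -mulr_sumr [RHS]mulrDl [X in _ = X + _]mulr_natl.
congr (_ + _); rewrite -!mulrA; case: n => [|n]; first by rewrite !mul0r mulr0.
by rewrite -exprSr.
Qed.

(** The integrand is |u|^4 |u u^T - I|^2, the random factor in the bound on |Y|^2. The recursion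
    yields d (d + 2) (d^2 + 9 d + 16). *)
Lemma gauss_norm_poly :
  expect (fun w => let s := \sum_i X i w ^+ 2 in s ^+ 2 * (s ^+ 2 - 2 * s + d%:R)) =
  d%:R ^+ 4 + 11 * d%:R ^+ 3 + 34 * d%:R ^+ 2 + 32 * d%:R.
Proof.
pose S w := \sum_i X i w ^+ 2.
have aS n : allmom (fun w => S w ^+ n).
  by apply: allmomX; apply: allmom_sum => i; apply: allmomX; exact: allmom_coord.
have -> : (fun w => let s := \sum_i X i w ^+ 2 in s ^+ 2 * (s ^+ 2 - 2 * s + d%:R))
    = (fun w => S w ^+ 4 + (-2 * S w ^+ 3 + d%:R * S w ^+ 2)).
  by apply/funext => w /=; rewrite /S; ring.
rewrite !expectD ?expectZ//; first last.
- by apply: allmomD; exact: allmomZ.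
- exact: allmomZ.
- exact: allmomZ.
rewrite !gauss_norm_rec.
have -> : expect (fun w => (\sum_i X i w ^+ 2) ^+ 0) = 1.
  by rewrite -(expect_cst P 1); congr expect.
by ring.
Qed.

(** A and B are random because they will depend on the past. The factorization hypothesis stands in
    for conditioning and is asked only for the monomials that occur. *)
Lemma expect_quadratic_forms (A B : T -> 'M[R]_d) :
  (forall i j, allmom (fun w => A w i j)) ->
  (forall i j, allmom (fun w => B w i j)) ->
  (forall w, (A w)^T = A w) ->
  (forall i j k l, expect (fun w => A w i j * B w k l *
       (X i w * X j w * (X k w * X l w - (k == l)%:R))) =
     expect (fun w => A w i j * B w k l) *
     expect (fun w => X i w * X j w * (X k w * X l w - (k == l)%:R))) ->
  expect (fun w => ip (v w) (A w *m v w) * (ip (v w) (B w *m v w) - \tr (B w))) =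
  2 * expect (fun w => \tr (A w *m B w)).
Proof.
move=> aA aB sA ind; have aX := allmom_coord hv.
have formE (C : 'M[R]_d) w : ip (v w) (C *m v w) =
    \sum_i \sum_j C i j * (X i w * X j w).
  rewrite ipE; apply: eq_bigr => i _; rewrite big_ord1 mxE mulr_sumr.
  by apply: eq_bigr => j _; rewrite /coords; ring.
have formT (C : 'M[R]_d) w : ip (v w) (C *m v w) - \tr C =
    \sum_k \sum_l C k l * (X k w * X l w - (k == l)%:R).
  rewrite formE -sumrB; apply: eq_bigr => i _.
  under [RHS]eq_bigr do rewrite mulrBr.
  rewrite sumrB; congr (_ - _); rewrite (bigD1 i)//= eqxx mulr1 big1 ?addr0//.
  by move=> j ji; rewrite eq_sym (negPf ji) mulr0.
have aP i j k l : allmom (fun w => X i w * X j w * (X k w * X l w - (k == l)%:R)).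
  apply: allmomM; first exact: allmomM.
  by apply: allmomB; [exact: allmomM|exact: allmom_cst].
have aAB i j k l : allmom (fun w => A w i j * B w k l) by exact: allmomM.
have -> : (fun w => ip (v w) (A w *m v w) * (ip (v w) (B w *m v w) - \tr (B w))) =
    (fun w => \sum_i \sum_j \sum_k \sum_l A w i j * B w k l *
       (X i w * X j w * (X k w * X l w - (k == l)%:R))).
  apply/funext => w; rewrite formE formT mulr_suml; apply: eq_bigr => i _.
  rewrite mulr_suml; apply: eq_bigr => j _; rewrite mulr_sumr.
  apply: eq_bigr => k _; rewrite mulr_sumr; apply: eq_bigr => l _; ring.
have a1 i j k l : allmom (fun w => A w i j * B w k l *
       (X i w * X j w * (X k w * X l w - (k == l)%:R))) by exact: allmomM.
rewrite expect_sum => [|i]; last by do 3 (apply: allmom_sum => ?).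
(* The two surviving pairings are (k, l) = (i, j) and (k, l) = (j, i). *)
transitivity (\sum_i \sum_j (expect (fun w => A w i j * B w i j) +
                             expect (fun w => A w i j * B w j i))).
  apply: eq_bigr => i _.
  rewrite expect_sum => [|j]; last by do 2 (apply: allmom_sum => ?).
  apply: eq_bigr => j _.
  rewrite expect_sum => [|k]; last by apply: allmom_sum => ?.
  under eq_bigr => k _.
    rewrite expect_sum => [|l]; last exact: a1.
    under eq_bigr do rewrite ind gauss_fourth mulrDr.
    rewrite big_split /= (bigD1 j)//= [X in _ + X + _]big1 => [|l lj]; last first.
      by rewrite [j == l]eq_sym (negPf lj) !mulr0.
    rewrite addr0 [X in _ + X](bigD1 i)//= [X in _ + (_ + X)]big1 => [|l li]; last first.
      by rewrite [i == l]eq_sym (negPf li) mul0r !mulr0.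
    rewrite !eqxx addr0 mulr1 mul1r.
    over.
  rewrite big_split /= (bigD1 i)//= [X in _ + X + _]big1 => [|k ki]; last first.
    by rewrite [i == k]eq_sym (negPf ki) !mulr0.
  rewrite addr0 [X in _ + X](bigD1 j)//= [X in _ + (_ + X)]big1 => [|k kj]; last first.
    by rewrite [j == k]eq_sym (negPf kj) !mulr0.
  by rewrite !eqxx addr0 !mulr1.
have sAB w i j : A w i j = A w j i by rewrite -{1}sA mxE.
transitivity (\sum_i \sum_j 2 * expect (fun w => A w i j * B w j i)).
  rewrite -[RHS]addr0.
  have -> : \sum_i \sum_j (expect (fun w => A w i j * B w i j) +
      expect (fun w => A w i j * B w j i)) =
      \sum_i \sum_j expect (fun w => A w i j * B w i j) +
      \sum_i \sum_j expect (fun w => A w i j * B w j i).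
    by rewrite -big_split; apply: eq_bigr => i _; rewrite -big_split.
  rewrite exchange_big /= addr0 -big_split; apply: eq_bigr => i _.
  rewrite -big_split; apply: eq_bigr => j _ /=.
  rewrite mulr_natl mulr2n; congr (_ + _); congr expect; apply/funext => w.
  by rewrite sAB.
have -> : (fun w => \tr (A w *m B w)) = (fun w => \sum_i \sum_j A w i j * B w j i).
  by apply/funext => w; rewrite /mxtrace; apply: eq_bigr => i _; rewrite mxE.
rewrite expect_sum => [|i]; last by apply: allmom_sum.
rewrite mulr_sumr; apply: eq_bigr => i _.
by rewrite expect_sum// mulr_sumr.
Qed.

End GaussianPolynomials.

Section LipschitzMeasurable.
Context {R : realType} {dsp : measure_display} {T : measurableType dsp}.

(* Measurability of a quantity that is only known to depend on Z in a Lipschitz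
   way, without a function relating the two. *)
Lemma lip_measurable m n p q (Z : T -> 'M[R]_(m, n)) (V : T -> 'M[R]_(p, q)) c :
  (forall i j, measurable_fun setT (fun w => Z w i j)) ->
  (forall w w', ip (V w - V w') (V w - V w') <= c * ip (Z w - Z w') (Z w - Z w')) ->
  forall i j, measurable_fun setT (fun w => V w i j).
Proof.
move=> mZ lip i j.
apply: (measurability (@RGenOInfty.G R)); first exact: RGenOInfty.measurableE.
move=> _ [_ [x ->] <-]; rewrite setTI.
pose box (r : 'M[rat]_(m, n) * nat) :=
  \bigcap_(a in [set: 'I_m]) \bigcap_(b in [set: 'I_n])
     ((fun w => Z w a b) @^-1` ball (ratr (r.1 a b) : R) (r.2.+1%:R^-1)).
have mbox r : measurable (box r).
  apply: fin_bigcap_measurable => // a _; apply: fin_bigcap_measurable => // b _.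
  by rewrite -[X in measurable X]setTI; apply: mZ => //; exact: measurable_ball.
(* U is a countable union: around each of its points there is a box in the values of Z, with
   rational centre and radius 1/(N+1), whose preimage stays in U. *)
pose U := (fun w => V w i j) @^-1` `]x, +oo[%classic.
pose sel r := if `[< box r `<=` U >] then box r else set0.
rewrite -/U; have -> : U = \bigcup_r sel r.
  apply/seteqP; split=> [w Uw|w [r _]]; last first.
    by rewrite /sel; case: asboolP => // h; exact: h.
  have dl : 0 < V w i j - x by move: Uw; rewrite /U /= in_itv /= andbT subr_gt0.
  set D := V w i j - x in dl.
  (* Two points of a box of radius below e differ by at most 2e in each entry of Z, so V moves by at
     most sqrt K e in norm. With D = (K + 1) e this is less than the distance D to the level x. *)
  pose K := `|c| * (m * n)%:R * 4.
  have K0 : 0 <= K by rewrite !mulr_ge0.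
  pose e := D / (K + 1).
  have e0 : 0 < e by rewrite divr_gt0// ltr_wpDl.
  pose N := Num.trunc e^-1.
  have Ne : N.+1%:R^-1 < e.
    by rewrite invf_plt ?posrE ?ltr0n//; exact: truncnS_gt.
  have N0 : 0 < N.+1%:R^-1 :> R by rewrite invr_gt0 ltr0n.
  have hr a b : exists r : rat, ball (ratr r : R) N.+1%:R^-1 (Z w a b).
    have : Z w a b - N.+1%:R^-1 < Z w a b + N.+1%:R^-1.
      by rewrite ltrBlDr -addrA ltrDl addr_gt0.
    move=> /rat_in_itvoo[r]; rewrite in_itv /= => /andP[r1 r2].
    exists r; rewrite /ball /= ltr_distlC.
    by rewrite ltrBlDr r2 -ltrBlDr r1.
  pose Q := \matrix_(a, b) projT1 (cid (hr a b)).
  exists (Q, N) => //; rewrite /sel.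
  have inb : box (Q, N) w.
    move=> a _ b _ /=; rewrite /Q mxE; exact: (projT2 (cid (hr a b))).
  case: asboolP => // nsub; exfalso; apply: nsub => w' bw'.
  rewrite /U /= in_itv /= andbT.
  have close a b : (Z w a b - Z w' a b) ^+ 2 <= 4 * (e ^+ 2).
    have := inb a I b I; have := bw' a I b I; rewrite /ball /= !ltr_norml.
    set s := ratr _; set y := Z w a b; set y' := Z w' a b; set t := N.+1%:R^-1 in Ne N0 *.
    move=> /andP[h1 h2] /andP[h3 h4].
    rewrite (_ : 4 * e ^+ 2 = (2 * e) ^+ 2); last by ring.
    rewrite -(real_normK (num_real (y - y'))) lerXn2r ?nnegrE//; first by rewrite mulr_ge0 ?ltW.
    by rewrite ler_norml; lra.
  have hZ : ip (Z w - Z w') (Z w - Z w') <= (m * n)%:R * (4 * e ^+ 2).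
    rewrite ipE; apply: (@le_trans _ _ (\sum_(a < m) \sum_(b < n) 4 * e ^+ 2)).
      by apply: ler_sum => a _; apply: ler_sum => b _; rewrite !mxE -expr2.
    rewrite !sumr_const !card_ord -mulrnA -[X in X <= _]mulr_natl mulnC.
    exact: lexx.
  have hV : (V w i j - V w' i j) ^+ 2 <= ip (V w - V w') (V w - V w').
    rewrite ipE (bigD1 i)//= (bigD1 j)//= !mxE -expr2 -addrA lerDl addr_ge0//.
      by apply: sumr_ge0 => b _; rewrite -expr2 sqr_ge0.
    by apply: sumr_ge0 => a _; apply: sumr_ge0 => b _; rewrite -expr2 sqr_ge0.
  have : (V w i j - V w' i j) ^+ 2 < D ^+ 2.
    apply: (le_lt_trans hV); apply: (le_lt_trans (lip _ _)).
    apply: (@le_lt_trans _ _ (`|c| * ((m * n)%:R * (4 * e ^+ 2)))).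
      apply: (@le_trans _ _ (`|c| * ip (Z w - Z w') (Z w - Z w'))).
        by rewrite ler_wpM2r ?ip_ge0 ?ler_norm.
      by rewrite ler_wpM2l.
    have -> : `|c| * ((m * n)%:R * (4 * e ^+ 2)) = K * e ^+ 2 by rewrite /K; ring.
    have De : D = (K + 1) * e by rewrite /e mulrC divfK// gt_eqF// ltr_wpDl.
    rewrite De (_ : ((K + 1) * e) ^+ 2 = K * e ^+ 2 + (K ^+ 2 + K + 1) * e ^+ 2).
      by rewrite ltrDl mulr_gt0 ?exprn_gt0// ltr_wpDl// addr_ge0 ?sqr_ge0.
    by ring.
  rewrite !ltNge; apply: contraNN => hle.
  have hD : D <= V w i j - V w' i j by rewrite lerD2l lerN2.
  by rewrite lerXn2r ?nnegrE// ?ltW// (lt_le_trans dl).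
apply: countable_bigcupT_measurable => [|r]; first exact: countableP.
rewrite /sel.
by case: asboolP.
Qed.

End LipschitzMeasurable.

(** * Quadratic objectives *)

Section QuadraticObjective.
Context {R : realType} {d : nat}.
Variables (f : 'cV[R]_d -> R) (Q : 'M[R]_d) (b : 'cV[R]_d) (c : R).
Hypothesis fE : forall x, f x = dotv x (Q *m x) + dotv b x + c.

(** Here the difference quotient is exactly a + h q; all derivatives of the objective are read off
    this way. *)
Lemma derive_expansion (phi : 'cV[R]_d -> R) (x v : 'cV[R]_d) (a q : R) :
  (forall h, phi (x + h *: v) = phi x + h * a + h ^+ 2 * q) -> 'D_v phi x = a.
Proof.
move=> hphi; apply: cvg_lim => //=.
have -> : a = a + 0 * q by rewrite mul0r addr0.
have lin : (a + h * q) @[h --> (0 : R)^'] --> a + 0 * q.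
  apply: cvgD; first exact: cvg_cst.
  apply: cvgM; last exact: cvg_cst.
  exact: cvg_within.
apply: cvg_trans lin; apply: near_eq_cvg; near=> h.
have h0 : h != 0 by near: h; exact: nbhs_dnbhs_neq.
rewrite /= [h *: v + x]addrC hphi /GRing.scale /=.
by field.
Unshelve. all: by end_near.
Qed.

Lemma derive_quadratic x v :
  'D_v f x = ip v ((Q + Q^T) *m x) + ip b v.
Proof.
apply: (@derive_expansion _ _ _ _ (ip v (Q *m v))) => h.
rewrite !fE !dotv_ip mulmxDr mulmxDl -scalemxAr !ip_lin.
have -> : ip v (Q^T *m x) = ip x (Q *m v) by rewrite -ip_mull ipC.
by ring.
Qed.

Lemma gradient_quadratic x : gradient f x = (Q + Q^T) *m x + b.
Proof.
apply/matrixP => i j; rewrite ord1 !mxE derive_quadratic /basisv.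
have dE (z : 'cV[R]_d) : ip (delta_mx i 0) z = z i 0.
  rewrite ipE (bigD1 i)//= big_ord1 !mxE !eqxx mul1r big1 ?addr0// => k ki.
  by rewrite big_ord1 !mxE (negPf ki) mul0r.
by rewrite [ip b _]ipC !dE !mxE.
Qed.

Lemma hessian_quadratic x : hessian f x = Q + Q^T.
Proof.
apply/matrixP => i j; rewrite mxE /basisv.
have -> : (fun y => 'D_(delta_mx j 0) f y) =
    (fun y => ip (delta_mx j 0) ((Q + Q^T) *m y) + ip b (delta_mx j 0)).
  by apply/funext => y; exact: derive_quadratic.
pose phi (y : 'cV[R]_d) := ip (delta_mx j 0) ((Q + Q^T) *m y) + ip b (delta_mx j 0).
rewrite (@derive_expansion phi _ _ (phi (delta_mx i 0) - phi 0) 0) /phi.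
  rewrite mulmx0 ip0r add0r addrK.
  rewrite ipE (bigD1 j)//= big_ord1 -colE !mxE !eqxx mul1r big1 ?addr0.
    by rewrite addrC.
  by move=> k ki; rewrite big_ord1 !mxE (negPf ki) mul0r.
by move=> h; rewrite mulmx0 ip0r mulmxDr -scalemxAr !ip_lin; ring.
Qed.

Lemma quadratic_form (x : 'cV[R]_d) : ip x ((Q + Q^T) *m x) = 2 * ip x (Q *m x).
Proof.
rewrite mulmxDl ipDr -[ip x (Q^T *m x)]ip_mull [ip (Q *m x) x]ipC.
by rewrite mulr_natl mulr2n.
Qed.

Lemma second_difference x v :
  f (x - v) + f (x + v) - 2 * f x = ip v ((Q + Q^T) *m v).
Proof.
rewrite quadratic_form !fE !dotv_ip !mulmxDr !mulmxN !ip_lin; ring.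
Qed.

(** At the pair (z, 0) the affine part cancels and the left side is half the Hessian form at z. *)
Lemma strongly_convex_form sigma (z : 'cV[R]_d) : strongly_convex sigma f ->
  sigma * ip z z <= ip z ((Q + Q^T) *m z).
Proof.
move=> /(_ z 0); rewrite gradient_quadratic mulmx0 add0r subr0 frob_sqr.
rewrite !fE !dotv_ip mulmx0 !ip0r quadratic_form; lra.
Qed.

Lemma smooth_form L (z : 'cV[R]_d) : smooth L f ->
  ip z ((Q + Q^T) *m z) <= L * ip z z.
Proof.
move=> /(_ z 0); rewrite !gradient_quadratic mulmx0 add0r subr0 addrK.
set y := _ *m z => hL.
have : ip z y <= frob z * frob y.
  apply: (le_trans (ler_norm _)).
  rewrite -ler_sqr ?nnegrE ?mulr_ge0 ?frob_ge0// real_normK ?num_real//.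
  by rewrite exprMn !frob_sqr ip_CS.
move=> h; apply: (le_trans h); rewrite -frob_sqr expr2 mulrCA.
by rewrite ler_wpM2l ?frob_ge0.
Qed.

End QuadraticObjective.

(** * One step of the algorithm *)

Section MatrixMeasurability.
Context {R : realType} {dsp : measure_display} {T : measurableType dsp}.

Definition mmeas m n (A : T -> 'M[R]_(m, n)) :=
  forall i j, measurable_fun setT (fun w => A w i j).

Lemma mmeas_cst m n (A : 'M[R]_(m, n)) : mmeas (fun=> A).
Proof. by move=> i j; exact: measurable_cst. Qed.

Lemma mmeasM m n p (A : T -> 'M[R]_(m, n)) (B : T -> 'M[R]_(n, p)) :
  mmeas A -> mmeas B -> mmeas (fun w => A w *m B w).
Proof.
move=> mA mB i j; under eq_fun do rewrite mxE.
by apply: measurable_sum => k; apply: measurable_funM.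
Qed.

Lemma mmeasD m n (A B : T -> 'M[R]_(m, n)) :
  mmeas A -> mmeas B -> mmeas (fun w => A w + B w).
Proof.
by move=> mA mB i j; under eq_fun do rewrite mxE; apply: measurable_funD.
Qed.

Lemma mmeasZ m n (c : T -> R) (A : T -> 'M[R]_(m, n)) :
  measurable_fun setT c -> mmeas A -> mmeas (fun w => c w *: A w).
Proof.
by move=> mc mA i j; under eq_fun do rewrite mxE; apply: measurable_funM.
Qed.

Lemma mmeasB m n (A B : T -> 'M[R]_(m, n)) :
  mmeas A -> mmeas B -> mmeas (fun w => A w - B w).
Proof.
move=> mA mB; under eq_fun do rewrite -scaleN1r.
by apply: mmeasD => //; apply: mmeasZ => //; exact: measurable_cst.
Qed.

Lemma mmeas_tr m n (A : T -> 'M[R]_(m, n)) : mmeas A -> mmeas (fun w => (A w)^T).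
Proof. by move=> mA i j; under eq_fun do rewrite mxE; exact: mA. Qed.

Lemma measurable_ip m n (A B : T -> 'M[R]_(m, n)) :
  mmeas A -> mmeas B -> measurable_fun setT (fun w => ip (A w) (B w)).
Proof.
move=> mA mB; under eq_fun do rewrite ipE.
by do 2 (apply: measurable_sum => ?); apply: measurable_funM.
Qed.

End MatrixMeasurability.

(** * The estimator for fixed matrices and a fixed draw *)

Section Estimator.
Context {R : realType} {d : nat}.
Variables (tau zeta : R).
Hypotheses (tau0 : 0 < tau) (tz : tau <= zeta).
Variable H : 'M[R]_d.

(* For the quadratic objective with Hessian H, the random part of the
   estimator G is Y - X, where X = Sigma^-1 and Rt = Sigma^(1/2). *)
Definition Yest (X Rt : 'M[R]_d) (v : 'cV[R]_d) : 'M[R]_d :=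
  (2^-1 * ip (Rt *m v) (H *m (Rt *m v))) *:
    (invmx Rt *m v *m v^T *m invmx Rt - X).

(** The identity [invmx Rt = X *m Rt] makes the inverse square root a product, so its measurability
    and moments come from those of [X] and [Rt]. *)
Lemma sqrt_unit (X Rt : 'M[R]_d) : between tau zeta X -> is_sqrtm (invmx X) Rt ->
  [/\ Rt^T = Rt, Rt \in unitmx, invmx Rt = X *m Rt, (invmx Rt)^T = invmx Rt &
      invmx Rt *m invmx Rt = X].
Proof.
move=> bX [[sR _] RR]; have uX := between_unit tau0 bX.
have : Rt *m Rt \in unitmx by rewrite RR unitmx_inv.
rewrite unitmx_mul => /andP[uR _].
have e : X *m Rt = invmx Rt.
  apply: (can_inj (mulmxK uR)); rewrite mulVmx// -mulmxA RR.
  by rewrite mulmxV.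
split=> //; first by rewrite trmx_inv sR.
by rewrite -{1}e -mulmxA mulmxV// mulmx1.
Qed.

Lemma sqrt_mulmx_le (X Rt : 'M[R]_d) (x : 'cV[R]_d) :
  between tau zeta X -> is_sqrtm (invmx X) Rt ->
  ip (Rt *m x) (Rt *m x) <= tau^-1 * ip x x.
Proof.
move=> bX sR; have [RT _ _ _ _] := sqrt_unit bX sR.
by rewrite ip_mull RT mulmxA sR.2; exact: ((between_inv tau0 tz bX).2 x).2.
Qed.

Lemma ip_sandwich (W C a : 'M[R]_d) : W^T = W ->
  ip a (W *m C *m W) = ip (W *m a *m W) C.
Proof. by move=> sW; rewrite ip_mulr ip_mull sW mulmxA. Qed.

Lemma ip_rank1 (B : 'M[R]_d) (v : 'cV[R]_d) : ip B (v *m v^T) = ip v (B *m v).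
Proof. by rewrite -ip_mulr ipC. Qed.

Lemma ip_1 n : ip (1%:M : 'M[R]_n) 1%:M = n%:R.
Proof. by rewrite /ip trmx1 mulmx1 mxtrace1. Qed.

(** Moving the outer factors of Y onto a leaves a product of a quadratic form and a centred one, the
    shape treated by [expect_quadratic_forms]. *)
Lemma ip_Yest (X Rt : 'M[R]_d) (v : 'cV[R]_d) (a : 'M[R]_d) :
  between tau zeta X -> is_sqrtm (invmx X) Rt -> a^T = a ->
  let A := Rt *m H *m Rt in let B := invmx Rt *m a *m invmx Rt in
  ip a (Yest X Rt v) = 2^-1 * (ip v (A *m v) * (ip v (B *m v) - \tr B)).
Proof.
move=> bX sR sa A B; have [RT uR _ WT WW] := sqrt_unit bX sR.
rewrite /Yest ipZr -mulrA; congr (_ * (_ * _)).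
  by rewrite ip_mull RT /A !mulmxA.
rewrite ipDr ipNr; congr (_ - _).
  by rewrite -(mulmxA _ v) ip_sandwich// ip_rank1.
by rewrite /ip sa /B [RHS]mxtrace_mulC mulmxA WW mxtrace_mulC.
Qed.

Lemma trace_sandwich (X Rt a : 'M[R]_d) :
  between tau zeta X -> is_sqrtm (invmx X) Rt -> H^T = H ->
  \tr ((Rt *m H *m Rt) *m (invmx Rt *m a *m invmx Rt)) = ip H a.
Proof.
move=> bX sR sH; have [RT uR _ WT WW] := sqrt_unit bX sR.
rewrite !mulmxA mulmxK// mxtrace_mulC !mulmxA mulVmx// mul1mx.
by rewrite /ip sH.
Qed.

(** Y is q/2 times the sandwich of v v^T - I by [invmx Rt]: the scalar q is at most (L / tau) |v|^2,
    and the sandwich costs a factor zeta^2 in squared norm. *)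
Lemma ip_Yest_le (L : R) (X Rt : 'M[R]_d) (v : 'cV[R]_d) :
  between tau zeta X -> is_sqrtm (invmx X) Rt ->
  (forall z : 'cV[R]_d, 0 <= ip z (H *m z) <= L * ip z z) ->
  ip (Yest X Rt v) (Yest X Rt v) <= L ^+ 2 * zeta ^+ 2 / (4 * tau ^+ 2) *
    (ip v v ^+ 2 * (ip v v ^+ 2 - 2 * ip v v + d%:R)).
Proof.
move=> bX sR hH; set s := ip v v; have [RT uR _ WT WW] := sqrt_unit bX sR.
have z0 := lt_le_trans tau0 tz.
rewrite /Yest; set q := ip (Rt *m v) _.
have Rv := sqrt_mulmx_le v bX sR.
have /andP[q0 q1] : 0 <= q <= L / tau * s.
  have /andP[h0 h1] := hH (Rt *m v); rewrite h0 /=; apply: (le_trans h1).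
  (* A negative L forces every vector to be zero, and both sides vanish. *)
  have [L0|L0] := leP 0 L; first by rewrite -mulrA ler_wpM2l.
  have hz (z : 'cV[R]_d) : ip z z = 0.
    have /andP[g0 g1] := hH z; have := ip_ge0 z; move: (le_trans g0 g1) => g2.
    by move=> g3; nra.
  by rewrite /s !hz !mulr0.
have -> : invmx Rt *m v *m v^T *m invmx Rt - X =
    invmx Rt *m (v *m v^T - 1%:M) *m invmx Rt.
  by rewrite mulmxBr mulmxBl mulmx1 WW !mulmxA.
rewrite ipZl ipZr.
have hW := @sandwich_le _ _ zeta (invmx Rt) X (v *m v^T - 1%:M) (ltW z0) WT WW
  (fun z => (bX.2 z).2).
have e : ip (v *m v^T - 1%:M) (v *m v^T - 1%:M) = s ^+ 2 - 2 * s + d%:R.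
  rewrite !ip_lin ip_1 [ip 1%:M _]ipC.
  have -> : ip (v *m v^T) 1%:M = s by rewrite ipC ip_rank1 mul1mx.
  have -> : ip (v *m v^T) (v *m v^T) = s ^+ 2.
    rewrite ip_rank1 -mulmxA /ip mulmxA mxtrace_mulC.
    by rewrite trace_mx11 mxE big_ord1 expr2 /s /ip trace_mx11.
  by ring.
rewrite e in hW; have p0 : 0 <= s ^+ 2 - 2 * s + d%:R by rewrite -e ip_ge0.
set p := s ^+ 2 - 2 * s + d%:R in hW p0 *.
rewrite mulrA; apply: (@le_trans _ _ (2^-1 * q * (2^-1 * q) * (zeta ^+ 2 * p))).
  by rewrite ler_wpM2l// !mulr_ge0.
have qq : q ^+ 2 <= (L / tau * s) ^+ 2 by rewrite lerXn2r// nnegrE (le_trans q0).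
rewrite (_ : 2^-1 * q * _ * _ = q ^+ 2 * (4^-1 * (zeta ^+ 2 * p))); last by field.
apply: (le_trans (ler_wpM2r _ qq)).
  by rewrite mulr_ge0// mulr_ge0// ltW// exprn_gt0.
by rewrite le_eqVlt; apply/orP; left; apply/eqP; field; rewrite gt_eqF.
Qed.

Lemma between_ip_le (X : 'M[R]_d) : between tau zeta X ->
  ip X X <= d%:R * zeta ^+ 2.
Proof.
move=> bX; have z0 := lt_le_trans tau0 tz.
have := @ip_mul_le _ _ _ _ (zeta ^+ 2) X 1%:M
  (fun x => between_sqr x (ltW tau0) (ltW z0) bX).
by rewrite mulmx1 ip_1 mulrC.
Qed.

Lemma ipB_le m n (A B : 'M[R]_(m, n)) :
  ip (A - B) (A - B) <= 2 * ip A A + 2 * ip B B.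
Proof. by have := ip_ge0 (A + B); rewrite !ip_lin (ipC B A); lra. Qed.

End Estimator.

(** * Measurability of one step *)

Section StepMeasurability.
Context {R : realType} {dsp : measure_display} {T : measurableType dsp}.
Context {d : nat}.
Variables (tau zeta : R).
Hypotheses (tau0 : 0 < tau) (tz : tau <= zeta).
Variables (X Rt : T -> 'M[R]_d).
Hypotheses (bX : forall w, between tau zeta (X w))
  (sR : forall w, is_sqrtm (invmx (X w)) (Rt w)) (mX : mmeas X).

(** The measurable space is a parameter, so these results also apply with the sigma-algebra of the
    past in place of the ambient one. *)
Lemma mmeas_sqrt : mmeas Rt.
Proof.
have z0 := lt_le_trans tau0 tz.
have mS : mmeas (fun w => invmx (X w)).
  by apply: (lip_measurable mX) => w w'; exact: (between_inv_lip tau0 tz (bX w) (bX w')).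
apply: (lip_measurable mS) => w w'.
have S0 : 0 < zeta^-1 by rewrite invr_gt0.
have S1 : 0 < tau^-1 by rewrite invr_gt0.
have bS x := between_inv tau0 tz (bX x).
exact: (sqrtm_lip S0 S1 (bS w) (bS w') (sR w) (sR w')).
Qed.

Lemma mmeas_invsqrt : mmeas (fun w => invmx (Rt w)).
Proof.
rewrite (_ : (fun _ => _) = fun w => X w *m Rt w).
  by apply: mmeasM => //; exact: mmeas_sqrt.
by apply/funext => w; have [] := sqrt_unit tau0 (bX w) (sR w).
Qed.

Lemma mmeas_Yest H (v : T -> 'cV[R]_d) : mmeas v ->
  mmeas (fun w => Yest H (X w) (Rt w) (v w)).
Proof.
move=> mv; have mR := mmeas_sqrt; have mW := mmeas_invsqrt.
have mRv : mmeas (fun w => Rt w *m v w) by exact: mmeasM.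
apply: mmeasZ.
  apply: measurable_funM => //; apply: measurable_ip => //.
  by apply: mmeasM => //; exact: mmeas_cst.
apply: mmeasB => //; apply: mmeasM => //; apply: mmeasM; first exact: mmeasM.
exact: mmeas_tr.
Qed.

Lemma mmeas_step H (v : T -> 'cV[R]_d) (eta : R) (X' : T -> 'M[R]_d) : mmeas v ->
  (forall w, is_proj (precset tau zeta)
     (X w + eta *: (Yest H (X w) (Rt w) (v w) - X w)) (X' w)) ->
  mmeas X'.
Proof.
move=> mv hp; have mY := mmeas_Yest H mv.
apply: (@lip_measurable _ _ _ _ _ _ _
  (fun w => X w + eta *: (Yest H (X w) (Rt w) (v w) - X w)) _ 1) => [|w w'].
  apply: mmeasD => //; apply: mmeasZ; first exact: measurable_cst.
  exact: mmeasB.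
by rewrite mul1r; exact: (proj_nonexp tau0 tz (hp w) (hp w')).
Qed.

End StepMeasurability.

(** * Expected squared error after one step *)

Section StepExpectation.
Context {R : realType} {dsp : measure_display} {T : measurableType dsp}.
Variable P : probability T R.
Context {d : nat}.
Variable G : set (set T).
Hypothesis Gm : G `<=` measurable.

Local Notation TG := (g_sigma_algebraType G).

Lemma sub_measurable_fun (h : T -> R) :
  measurable_fun setT (h : TG -> R) -> measurable_fun setT h.
Proof.
move=> mh _ B mB; have := mh measurableT B mB.
exact: (smallest_sub (@sigma_algebra_measurable _ T) Gm).
Qed.

(** Two sigma-algebras are involved: measurability refers to the past generated by [G], moments to
    the ambient probability. *)
Definition past_allmom m n (A : T -> 'M[R]_(m, n)) :=
  mmeas (A : TG -> 'M[R]_(m, n)) /\ forall i j, allmom P (fun w => A w i j).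

Lemma past_allmom_cst m n (A : 'M[R]_(m, n)) : past_allmom (fun=> A).
Proof. by split=> [|i j]; [exact: mmeas_cst|exact: allmom_cst]. Qed.

Lemma past_allmomM m n p (A : T -> 'M[R]_(m, n)) (B : T -> 'M[R]_(n, p)) :
  past_allmom A -> past_allmom B -> past_allmom (fun w => A w *m B w).
Proof.
move=> [mA aA] [mB aB]; split; first exact: mmeasM.
move=> i j; under eq_fun do rewrite mxE.
by apply: allmom_sum => k; exact: allmomM.
Qed.

Lemma past_allmomB m n (A B : T -> 'M[R]_(m, n)) :
  past_allmom A -> past_allmom B -> past_allmom (fun w => A w - B w).
Proof.
move=> [mA aA] [mB aB]; split; first exact: mmeasB.
by move=> i j; under eq_fun do rewrite !mxE; exact: allmomB.
Qed.

Lemma past_allmomZ m n c (A : T -> 'M[R]_(m, n)) : past_allmom A -> past_allmom (fun w => c *: A w).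
Proof.
move=> [mA aA]; split; first by apply: mmeasZ => //; exact: measurable_cst.
by move=> i j; under eq_fun do rewrite !mxE; exact: allmomZ.
Qed.

Lemma ip_sqrDZ m n (A B : 'M[R]_(m, n)) c :
  ip (A + c *: B) (A + c *: B) = ip A A + (2 * c * ip A B + c ^+ 2 * ip B B).
Proof. by rewrite !ip_lin (ipC B A); ring. Qed.

Lemma entry_sqr_le m n (A : 'M[R]_(m, n)) i j : A i j ^+ 2 <= ip A A.
Proof.
rewrite ipE (bigD1 i)//= (bigD1 j)//= -expr2 -addrA lerDl addr_ge0//.
  by apply: sumr_ge0 => b _; rewrite -expr2 sqr_ge0.
by apply: sumr_ge0 => a _; apply: sumr_ge0 => b _; rewrite -expr2 sqr_ge0.
Qed.

Lemma past_allmom_bounded m n (A : T -> 'M[R]_(m, n)) c :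
  mmeas (A : TG -> 'M[R]_(m, n)) -> (forall w, ip (A w) (A w) <= c) -> past_allmom A.
Proof.
(* The entry has square at most c, hence absolute value at most 1 + c, which avoids a square
   root. *)
move=> mA hA; split=> // i j; apply: (@allmom_bounded _ _ _ _ _ (1 + c)).
  exact: sub_measurable_fun (mA i j).
move=> w; have h := le_trans (entry_sqr_le (A w) i j) (hA w).
have c0 : 0 <= c by apply: le_trans h; exact: sqr_ge0.
rewrite -ler_sqr ?nnegrE ?addr_ge0// real_normK ?num_real//; nra.
Qed.

Lemma allmom_ip m n (A B : T -> 'M[R]_(m, n)) :
  (forall i j, allmom P (fun w => A w i j)) ->
  (forall i j, allmom P (fun w => B w i j)) ->
  allmom P (fun w => ip (A w) (B w)).
Proof.
move=> aA aB; under eq_fun do rewrite ipE.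
by do 2 (apply: allmom_sum => ?); exact: allmomM.
Qed.

Variables (tau zeta L : R).
Hypotheses (tau0 : 0 < tau) (tz : tau <= zeta).
Variable H : 'M[R]_d.
Hypotheses (sH : H^T = H)
  (hH : forall z : 'cV[R]_d, 0 <= ip z (H *m z) <= L * ip z z).
Variables (v : T -> 'cV[R]_d) (X Rt : T -> 'M[R]_d).
Hypotheses (hv : std_gaussian P v)
  (vG : indep_sys P (sigma_vec v) <<s G >>)
  (bX : forall w, between tau zeta (X w))
  (sR : forall w, is_sqrtm (invmx (X w)) (Rt w))
  (mX : mmeas (X : TG -> 'M[R]_d)).

(** The second generating family is the one behind [sigma_vec], spelled out because a measurable
    type is built from generators. *)
Lemma expect_indep_past (c h : T -> R) : allmom P c -> allmom P h ->
  measurable_fun setT (c : TG -> R) ->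
  measurable_fun setT (h : g_sigma_algebraType
    (\big[setU/set0]_(i < d) preimage_set_system setT (coords v i) measurable) -> R) ->
  expect P (fun w => c w * h w) = expect P c * expect P h.
Proof.
move=> ac ah mc mh; apply: expect_indep => // A B mA mB.
have hB : sigma_vec v (h @^-1` B).
  by have := mh measurableT B mB; rewrite setTI.
have hA : <<s G >> (c @^-1` A).
  by have := mc measurableT A mA; rewrite setTI.
by rewrite setIC muleC; exact: vG.
Qed.

Lemma measurable_coord_gen i :
  measurable_fun setT ((coords v i) : g_sigma_algebraType
    (\big[setU/set0]_(i < d) preimage_set_system setT (coords v i) measurable) -> R).
Proof.
move=> _ B mB; apply: sub_sigma_algebra; rewrite (bigD1 i)//=; left.
by exists B.
Qed.

Lemma past_allmom_X : past_allmom X.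
Proof. by apply: (past_allmom_bounded mX) => w; exact: between_ip_le (bX w). Qed.

Lemma past_allmom_Rt : past_allmom Rt.
Proof.
apply: (@past_allmom_bounded _ _ _ (tau^-1 * d%:R)).
  exact: (@mmeas_sqrt _ _ TG _ _ _ tau0 tz X).
move=> w; have := @ip_mul_le _ _ _ _ tau^-1 (Rt w) 1%:M
  (fun x => sqrt_mulmx_le tau0 tz x (bX w) (sR w)).
by rewrite mulmx1 ip_1.
Qed.

Lemma past_allmom_W : past_allmom (fun w => invmx (Rt w)).
Proof.
rewrite (_ : (fun _ => _) = fun w => X w *m Rt w).
  by apply: past_allmomM; [exact: past_allmom_X|exact: past_allmom_Rt].
by apply/funext => w; have [] := sqrt_unit tau0 (bX w) (sR w).
Qed.

Let A w := Rt w *m H *m Rt w.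

Lemma past_allmom_A : past_allmom A.
Proof.
apply: past_allmomM; last exact: past_allmom_Rt.
by apply: past_allmomM; [exact: past_allmom_Rt|exact: past_allmom_cst].
Qed.

(** E[Y | past] = H in weak form: instead of a conditional expectation, Y is paired with every
    symmetric matrix determined by the past. *)
Lemma expect_ip_Yest (a : T -> 'M[R]_d) : past_allmom a -> (forall w, (a w)^T = a w) ->
  expect P (fun w => ip (a w) (Yest H (X w) (Rt w) (v w))) =
  expect P (fun w => ip H (a w)).
Proof.
move=> ga sa; pose B w := invmx (Rt w) *m a w *m invmx (Rt w).
have gB : past_allmom B by apply: past_allmomM; [apply: past_allmomM => //|]; exact: past_allmom_W.
have gA := past_allmom_A.
have aX := allmom_coord hv.
have -> : (fun w => ip (a w) (Yest H (X w) (Rt w) (v w))) = (fun w =>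
    2^-1 * (ip (v w) (A w *m v w) * (ip (v w) (B w *m v w) - \tr (B w)))).
  by apply/funext => w; exact: (ip_Yest tau0 H (v w) (bX w) (sR w) (sa w)).
have aV i j : allmom P (fun w => v w i j) by rewrite ord1; exact: aX.
have aform C : past_allmom C -> allmom P (fun w => ip (v w) (C w *m v w)).
  move=> [_ aC]; apply: allmom_ip => // i j; under eq_fun do rewrite mxE.
  by apply: allmom_sum => k; exact: allmomM.
have atr : allmom P (fun w => \tr (B w)).
  by rewrite /mxtrace; apply: allmom_sum => i; exact: gB.2.
rewrite expectZ; last by apply: allmomM; [exact: aform|apply: allmomB => //; exact: aform].
rewrite (expect_quadratic_forms hv gA.2 gB.2); last 2 first.
- move=> w; have [RT _ _ _ _] := sqrt_unit tau0 (bX w) (sR w).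
  by rewrite /A !trmx_mul RT sH mulmxA.
- move=> i j k l; apply: expect_indep_past.
  + by apply: allmomM; [exact: gA.2|exact: gB.2].
  + apply: allmomM; first exact: allmomM.
    by apply: allmomB; [exact: allmomM|exact: allmom_cst].
  + by apply: measurable_funM; [exact: gA.1|exact: gB.1].
  + have mc := measurable_coord_gen.
    apply: measurable_funM; first exact: measurable_funM.
    by apply: measurable_funB; [exact: measurable_funM|exact: measurable_cst].
rewrite mulKf// ?pnatr_eq0//; congr (expect P); apply/funext => w.
exact: (trace_sandwich tau0 (a w) (bX w) (sR w) sH).
Qed.

Let M := L ^+ 2 * zeta ^+ 2 / (4 * tau ^+ 2) *
  (d%:R ^+ 4 + 11 * d%:R ^+ 3 + 34 * d%:R ^+ 2 + 32 * d%:R)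
  + 2 * d%:R * zeta ^+ 2 + ip H H.

Lemma expect_step (eta : R) (X' : T -> 'M[R]_d) :
  precset tau zeta H ->
  (forall i j, measurable_fun setT (fun w => X' w i j)) ->
  (forall w, is_proj (precset tau zeta)
     (X w + eta *: (Yest H (X w) (Rt w) (v w) - X w)) (X' w)) ->
  expect P (fun w => ip (X' w - H) (X' w - H)) <=
  (1 - 2 * eta) * expect P (fun w => ip (X w - H) (X w - H)) + eta ^+ 2 * M.
Proof.
move=> HS mX' hp.
pose kap := L ^+ 2 * zeta ^+ 2 / (4 * tau ^+ 2).
(* The part of the unprojected error that is determined by the past; the remainder is eta Y. *)
pose a w := (1 - eta) *: X w - H.
pose S w := \sum_i coords v i w ^+ 2.
pose p w := S w ^+ 2 * (S w ^+ 2 - 2 * S w + d%:R).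
pose Y w := Yest H (X w) (Rt w) (v w).
have sa w : (a w)^T = a w by rewrite /a linearB linearZ /= (bX w).1 sH.
have ga : past_allmom a.
  by apply: past_allmomB; [apply: past_allmomZ; exact: past_allmom_X|exact: past_allmom_cst].
have aX := allmom_coord hv.
have aS n : allmom P (fun w => S w ^+ n).
  by apply: allmomX; apply: allmom_sum => i; exact: allmomX.
have ap : allmom P p.
  apply: allmomM => //; apply: allmomD; last exact: allmom_cst.
  by apply: allmomB => //; apply: allmomZ; exact: (aS 1%N).
have SE w : ip (v w) (v w) = S w.
  by rewrite ipE /S; apply: eq_bigr => i _; rewrite big_ord1 -expr2.
have gXH : past_allmom (fun w => X w - H).
  by apply: past_allmomB; [exact: past_allmom_X|exact: past_allmom_cst].
have aXH : allmom P (fun w => ip (X w - H) (X w - H)) by apply: allmom_ip; exact: gXH.2.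
have aaa : allmom P (fun w => ip (a w) (a w)) by apply: allmom_ip; exact: ga.2.
have aY : allmom P (fun w => ip (a w) (Y w)).
  have gW := past_allmom_W; have gX := past_allmom_X; have gR := past_allmom_Rt.
  have aV i j : allmom P (fun w => v w i j) by rewrite ord1; exact: aX.
  have aM m n q (C : T -> 'M[R]_(m, n)) (D : T -> 'M[R]_(n, q)) :
      (forall i j, allmom P (fun w => C w i j)) ->
      (forall i j, allmom P (fun w => D w i j)) ->
      forall i j, allmom P (fun w => (C w *m D w) i j).
    move=> aC aD i j; under eq_fun do rewrite mxE.
    by apply: allmom_sum => k; exact: allmomM.
  apply: allmom_ip; first exact: ga.2.
  have mB (C D : 'M[R]_d) k l : (C - D) k l = C k l - D k l by rewrite !mxE.
  move=> i j; rewrite /Y /Yest; under eq_fun do rewrite mxE mB.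
  have aRv : forall i j, allmom P (fun w => (Rt w *m v w) i j) by exact: aM gR.2 _.
  apply: allmomM.
    apply: allmomZ; apply: allmom_ip => //; apply: aM => // *; exact: allmom_cst.
  apply: allmomB; last exact: gX.2.
  apply: (aM _ _ _ (fun w => invmx (Rt w) *m v w *m (v w)^T)); last exact: gW.2.
  apply: (aM _ _ _ (fun w => invmx (Rt w) *m v w)).
    by apply: aM => //; exact: gW.2.
  by move=> k l; under eq_fun do rewrite mxE.
have aH : allmom P (fun w => ip H (a w)).
  by apply: allmom_ip => [i j|]; [exact: allmom_cst|exact: ga.2].
have pX' w : precset tau zeta (X' w) by have [] := hp w.
have aX' : allmom P (fun w => ip (X' w - H) (X' w - H)).
  have h : forall i j, allmom P (fun w => (X' w - H) i j).
    move=> i j; under eq_fun do rewrite 2!mxE.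
    apply: allmomB; last exact: allmom_cst.
    apply: (@allmom_bounded _ _ _ _ _ (1 + d%:R * zeta ^+ 2)) => [|w].
      exact: mX'.
    have hb : between tau zeta (X' w) by apply/precsetP.
    have h := le_trans (entry_sqr_le (X' w) i j) (between_ip_le tau0 tz hb).
    have c0 : 0 <= d%:R * zeta ^+ 2 by rewrite mulr_ge0// sqr_ge0.
    rewrite -ler_sqr ?nnegrE ?addr_ge0// real_normK ?num_real//; nra.
  exact: allmom_ip.
(* H lies in S', so it is its own projection and nonexpansiveness bounds the new error by the
   unprojected one. *)
have step w : ip (X' w - H) (X' w - H) <=
    ip (a w) (a w) + (2 * eta * ip (a w) (Y w) + eta ^+ 2 * (kap * p w)).
  have projH : is_proj (precset tau zeta) H H.
    split=> // Z _; rewrite subrr frob_le ip0r ip_ge0//.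
  apply: (le_trans (proj_nonexp tau0 tz (hp w) projH)).
  have -> : X w + eta *: (Yest H (X w) (Rt w) (v w) - X w) - H = a w + eta *: Y w.
    rewrite /a /Y scalerBr scalerBl scale1r addrA -!addrA; congr (_ + _).
    by rewrite addrC -!addrA; congr (_ + _); rewrite addrC.
  have hY := ip_Yest_le tau0 tz (v w) (bX w) (sR w) hH.
  rewrite !SE -/kap -/(p w) -/(Y w) in hY.
  by rewrite ip_sqrDZ !lerD2l ler_wpM2l ?sqr_ge0.
apply: (le_trans (expect_le aX' _ step)).
  by apply: allmomD => //; apply: allmomD; apply: allmomZ => //; exact: allmomZ.
rewrite expectD//; last by apply: allmomD; apply: allmomZ => //; exact: allmomZ.
rewrite expectD; [|exact: allmomZ|by apply: allmomZ; exact: allmomZ].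
rewrite !expectZ//; last exact: allmomZ.
rewrite (expect_ip_Yest ga sa) (gauss_norm_poly hv).
rewrite addrA -expectZ// -expectD//; last exact: allmomZ.
set q := _ + 32 * _.
apply: (@le_trans _ _ (expect P (fun w => (1 - 2 * eta) * ip (X w - H) (X w - H) +
    cst (eta ^+ 2 * (2 * d%:R * zeta ^+ 2 + ip H H)) w) + eta ^+ 2 * (kap * q))).
  rewrite lerD2r; apply: expect_le => [||w].
  - by apply: allmomD => //; exact: allmomZ.
  - by apply: allmomD; [exact: allmomZ|exact: allmom_cst].
  have h1 := between_ip_le tau0 tz (bX w).
  have h2 := ipB_le (X w) H.
  (* Completing the square: a + eta H = (1 - eta) (X - H). *)
  have -> : ip (a w) (a w) + 2 * eta * ip H (a w) =
      (1 - 2 * eta) * ip (X w - H) (X w - H) +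
      eta ^+ 2 * (ip (X w - H) (X w - H) - ip H H).
    by rewrite /a !ip_lin (ipC (X w) H); ring.
  rewrite lerD2l /cst ler_wpM2l ?sqr_ge0//; lra.
rewrite expectD; [|exact: allmomZ|exact: allmom_cst].
rewrite expectZ// expect_cst /M -/kap -/q -addrA lerD2l -mulrDr.
by rewrite ler_wpM2l ?sqr_ge0// addrC addrA.
Qed.

End StepExpectation.

(** * The rate *)

Lemma mines_G_quadratic (R : realType) (d : nat) (f : 'cV[R]_d -> R)
    (Q : 'M[R]_d) (b : 'cV[R]_d) (c alpha : R) (mu : 'cV[R]_d)
    (S Rt : 'M[R]_d) (u : 'cV[R]_d) : alpha != 0 ->
  (forall x, f x = dotv x (Q *m x) + dotv b x + c) ->
  mines_G f alpha mu S Rt u = Yest (Q + Q^T) (invmx S) Rt u - invmx S.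
Proof.
move=> a0 fE; rewrite /mines_G /Yest (second_difference fE) -scalemxAr ipZl ipZr.
by congr (_ *: _ - _); field.
Qed.

(** * The sigma-algebra of the earlier draws *)

Section Past.
Context {R : realType} {dsp : measure_display} {T : measurableType dsp}.
Variable P : probability T R.
Context {d : nat}.
Variables (u : nat -> T -> 'cV[R]_d) (hu : gaussian_draws P u).

Definition past_gen k := \bigcup_(j in [set j | (0 < j < k)%N]) sigma_vec (u j).

Lemma past_gen_measurable k : past_gen k `<=` measurable.
Proof.
move=> A [j /= /andP[j0 _]]; apply: smallest_sub.
  exact: sigma_algebra_measurable.
elim/big_ind: _ => [||i _]; first exact: sub0set.
  by move=> ? ? h1 h2 B [/h1|/h2].
by move=> _ [B mB <-]; exact: (hu j0).1.1.
Qed.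

Lemma measurable_past_coord k i : (0 < k)%N ->
  measurable_fun setT (coords (u k) i : g_sigma_algebraType (past_gen k.+1) -> R).
Proof.
move=> k0 _ B mB; apply: sub_sigma_algebra; exists k; first by rewrite /= k0 ltnS leqnn.
apply: sub_sigma_algebra; rewrite (bigD1 i)//=; left.
by exists B.
Qed.

Lemma measurable_past_mono k (h : T -> R) :
  measurable_fun setT (h : g_sigma_algebraType (past_gen k) -> R) ->
  measurable_fun setT (h : g_sigma_algebraType (past_gen k.+1) -> R).
Proof.
move=> mh _ B mB; have := mh measurableT B mB.
apply: sub_sigma_algebra2 => A [j /= /andP[j0 jk] hA]; exists j => //=.
by rewrite j0 (ltn_trans jk).
Qed.

End Past.

(** For k >= 2 the coefficient 1 - 2/k is nonnegative, so the bound on e may be inserted. The result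
    (k - 1)/k^2 is at most 1/(k + 1) because (k - 1)(k + 1) <= k^2. *)
Lemma rate_step (R : realType) (C M e e' : R) (k : nat) : (1 < k)%N ->
  M <= C -> 0 <= C -> e <= k%:R^-1 * C ->
  e' <= (1 - 2 * k%:R^-1) * e + k%:R^-1 ^+ 2 * M ->
  e' <= k.+1%:R^-1 * C.
Proof.
move=> k1 MC C0 he he'; apply: (le_trans he').
have k0 : 2 <= k%:R :> R by rewrite ler_nat.
rewrite (_ : k.+1%:R = k%:R + 1 :> R); last by rewrite natr1.
set x : R := k%:R in k0 he *.
have xi : 0 < x^-1 by rewrite invr_gt0; lra.
have p1 : 0 <= 1 - 2 * x^-1.
  by rewrite subr_ge0 ler_pdivrMr ?mul1r//; lra.
apply: (@le_trans _ _ ((1 - 2 * x^-1) * (x^-1 * C) + x^-1 ^+ 2 * C)).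
  by apply: lerD; rewrite ler_wpM2l// sqr_ge0.
rewrite (_ : _ + _ = (x - 1) / x ^+ 2 * C); last by field; rewrite gt_eqF//; lra.
rewrite ler_wpM2r// ler_pdivrMr ?exprn_gt0//; last lra.
rewrite ler_pdivlMl; [nra|lra].
Qed.

Theorem corollary6 (R : realType) (d : nat)
  (dsp : measure_display) (T : measurableType dsp) (P : probability T R)
  (alpha tau zeta L sigma : R) (f : 'cV[R]_d -> R) (H : 'M[R]_d)
  (eta1 : nat -> R) (mu1 : 'cV[R]_d) (Sigma1 : 'M[R]_d)
  (u mu : nat -> T -> 'cV[R]_d) (Sigma : nat -> T -> 'M[R]_d)
  (halpha : 0 < alpha) (htau : 0 < tau) (htauzeta : tau <= zeta)
  (hquad : quadratic f) (hhess : forall x, hessian f x = H)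
  (hsmooth : smooth L f) (hconvex : strongly_convex sigma f)
  (hzeta : L <= zeta) (htausigma : tau <= sigma)
  (heta1 : forall k : nat, (0 < k)%N -> 0 < eta1 k)
  (hSigma1 : covset tau zeta Sigma1)
  (hu : gaussian_draws P u)
  (hmines : mines f alpha tau zeta eta1 (fun k => k%:R^-1) mu1 Sigma1
              u mu Sigma) :
  let M := L ^+ 2 * zeta ^+ 2 / (4 * tau ^+ 2) *
             (d%:R ^+ 4 + 11 * d%:R ^+ 3 + 34 * d%:R ^+ 2 + 32 * d%:R)
           + 2 * d%:R * zeta ^+ 2 + frob H ^+ 2 in
  forall k : nat, (0 < k)%N ->
    ('E_P[fun w => (frob (invmx (Sigma k w) - H) ^+ 2)%R] <=
       (k%:R^-1 * Num.max (frob (invmx Sigma1 - H) ^+ 2) M)%:E)%E.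
Proof.
move=> M; have [Q [b [c fE]]] := hquad.
have HE : H = Q + Q^T by rewrite -(hhess 0) (hessian_quadratic fE).
have z0 := lt_le_trans htau htauzeta.
have sH : H^T = H by rewrite HE linearD /= trmxK addrC.
have lH (z : 'cV[R]_d) : sigma * ip z z <= ip z (H *m z).
  by rewrite HE; exact: (strongly_convex_form fE).
have uH (z : 'cV[R]_d) : ip z (H *m z) <= L * ip z z.
  by rewrite HE; exact: (smooth_form fE).
(* Here tau <= sigma and L <= zeta place H in S'. *)
have bH : between tau zeta H.
  split=> // z; have i0 := ip_ge0 z; split.
    by apply: le_trans (lH z); rewrite ler_wpM2r.
  by apply: (le_trans (uH z)); rewrite ler_wpM2r.
have hH (z : 'cV[R]_d) : 0 <= ip z (H *m z) <= L * ip z z.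
  by rewrite uH andbT (le_trans _ (bH.2 z).1)// mulr_ge0 ?ip_ge0// ltW.
have SH : precset tau zeta H by apply/precsetP.
pose X k w := invmx (Sigma k w).
pose e k := expect P (fun w => ip (X k w - H) (X k w - H)).
have X1 w : X 1%N w = invmx Sigma1 by rewrite /X (hmines.1 w).2.
have bX k w : (0 < k)%N -> between tau zeta (X k w).
  case: k => // -[|k] _; last first.
    by have [Rt [_ _ [+ _]]] := hmines.2 k.+1 w isT; rewrite precsetP.
  rewrite X1 -[tau]invrK -[zeta]invrK; apply: between_inv.
  - by rewrite invr_gt0.
  - by rewrite lef_pV2.
  - exact/covsetP.
have stepX k : (0 < k)%N -> exists Rt : T -> 'M[R]_d,
    (forall w, is_sqrtm (invmx (X k w)) (Rt w)) /\
    (forall w, is_proj (precset tau zeta)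
      (X k w + k%:R^-1 *: (Yest H (X k w) (Rt w) (u k w) - X k w)) (X k.+1 w)).
  move=> k0; have /choice[Rt hRt] : forall w, exists Rt,
      is_sqrtm (invmx (X k w)) Rt /\ is_proj (precset tau zeta)
      (X k w + k%:R^-1 *: (Yest H (X k w) Rt (u k w) - X k w)) (X k.+1 w).
    move=> w; have [Rt [sR _ pR]] := hmines.2 k w k0; exists Rt.
    split; first by rewrite invmxK.
    by rewrite HE -(mines_G_quadratic (mu k w) _ _ _ (lt0r_neq0 halpha) fE).
  by exists Rt; split=> w; have [] := hRt w.
have mX k : (0 < k)%N ->
    mmeas (X k : g_sigma_algebraType (past_gen u k) -> 'M[R]_d).
  elim: k => // -[_ _|k IHk _].
    rewrite (_ : X 1%N = fun=> invmx Sigma1); first exact: mmeas_cst.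
    by apply/funext => w; exact: X1.
  have [Rt [sR pR]] := stepX k.+1 isT.
  apply: (@mmeas_step _ _ (g_sigma_algebraType (past_gen u k.+2)) _ _ _ htau
    htauzeta (X k.+1) Rt _ sR _ H (u k.+1) (k.+1%:R^-1)) => //.
  - by move=> w; exact: bX.
  - by move=> i j; apply: measurable_past_mono; exact: IHk.
  - by move=> i j; rewrite ord1; exact: measurable_past_coord.
have gX k : (0 < k)%N -> past_allmom P (past_gen u k) (X k).
  move=> k0; apply: (past_allmom_X P (past_gen_measurable hu (k := k)) htau htauzeta).
    by move=> w; exact: bX.
  exact: mX.
have aX k : (0 < k)%N -> allmom P (fun w => ip (X k w - H) (X k w - H)).
  move=> k0; have [_ h] := past_allmomB (gX k k0) (past_allmom_cst P (past_gen u k) H).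
  exact: allmom_ip.
have eE k : (0 < k)%N ->
    'E_P[fun w => (frob (invmx (Sigma k w) - H) ^+ 2)%R]%E = (e k)%:E.
  by move=> k0; under eq_fun do rewrite frob_sqr; rewrite expect_expectation//; exact: aX.
move=> k k0; rewrite eE// lee_fin; set C := Num.max _ M.
have MC : M <= C by rewrite le_max lexx orbT.
have C0 : 0 <= C by rewrite le_max sqr_ge0.
have eS n : (0 < n)%N -> e n.+1 <= (1 - 2 * n%:R^-1) * e n + n%:R^-1 ^+ 2 * M.
  move=> n0; have [Rt [sR pR]] := stepX n n0.
  have [gu iu] := hu n n0.
  rewrite /M frob_sqr; apply: (expect_step (past_gen_measurable hu (k := n)) htau
    htauzeta sH hH gu iu _ sR (mX n n0)) => //.
  - by move=> w; exact: bX.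
  - move=> i j; apply: (sub_measurable_fun (past_gen_measurable hu (k := n.+1))).
    exact: mX.
have e2 : e 2%N <= 2^-1 * C.
  apply: (@le_trans _ _ (2^-1 * M)); last by rewrite ler_wpM2l.
  (* A deterministic bound on |X_2 - H|^2. With D = d zeta^2 and |H|^2 <= D, the inequality B <= M/2
     needs only K >= 5 D. *)
  pose B := 2 * (d%:R * zeta ^+ 2) + 2 * ip H H.
  apply: (@le_trans _ _ B).
    rewrite -[B](expect_cst P); apply: expect_le => [||w]; first exact: aX.
      exact: allmom_cst.
    apply: (le_trans (ipB_le _ _)); rewrite /cst lerD2r ler_wpM2l//.
    exact: (between_ip_le htau htauzeta (bX 2%N w isT)).
  have hHH := between_ip_le htau htauzeta bH.
  have h0 := ip_ge0 H.
  set D := d%:R * zeta ^+ 2 in B hHH *.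
  have KD : 8 * D <= L ^+ 2 * zeta ^+ 2 / (4 * tau ^+ 2) *
      (d%:R ^+ 4 + 11 * d%:R ^+ 3 + 34 * d%:R ^+ 2 + 32 * d%:R).
    (* Comparing tau with L requires a nonzero vector; in dimension 0 both sides vanish. *)
    have [d0|d0] := posnP d.
      by rewrite /D d0 !expr0n /= !(mul0r, mulr0, addr0).
    have tL : tau <= L.
      have e1E : ip (delta_mx (Ordinal d0) 0 : 'cV[R]_d) (delta_mx (Ordinal d0) 0) = 1.
        rewrite ipE (bigD1 (Ordinal d0))//= big_ord1 !mxE !eqxx mul1r big1 ?addr0//.
        by move=> i /negPf ni; rewrite big_ord1 !mxE ni mul0r.
      have h := le_trans (bH.2 (delta_mx (Ordinal d0) 0)).1 (uH _).
      by rewrite e1E !mulr1 in h.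
    have Lt : 1 <= L ^+ 2 / tau ^+ 2.
      rewrite ler_pdivlMr ?exprn_gt0// mul1r lerXn2r// nnegrE ltW//.
      exact: lt_le_trans tL.
    rewrite (_ : L ^+ 2 * zeta ^+ 2 / (4 * tau ^+ 2) =
      L ^+ 2 / tau ^+ 2 * (4^-1 * zeta ^+ 2)); last by field; rewrite gt_eqF.
    have p0 : 8 * D <= 4^-1 * zeta ^+ 2 *
        (d%:R ^+ 4 + 11 * d%:R ^+ 3 + 34 * d%:R ^+ 2 + 32 * d%:R).
      (* The linear term 32 d alone suffices: 32 / 4 = 8. *)
      rewrite (_ : 8 * D = 4^-1 * zeta ^+ 2 * (32 * d%:R)); last by rewrite /D; field.
      apply: ler_wpM2l; first by apply: mulr_ge0 => //; exact: sqr_ge0.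
      rewrite lerDr.
      by rewrite !addr_ge0// ?mulr_ge0// exprn_ge0.
    apply: (le_trans p0); rewrite -[leRHS]mulrA ler_peMl//.
    by apply: le_trans p0; do 2 apply: mulr_ge0 => //; exact: sqr_ge0.
  rewrite /B /M frob_sqr -(mulrA 2) -/D.
  by move: KD; set K := L ^+ 2 * _ / _ * _; lra.
(* Two base cases: k = 1, where X_1 is deterministic, and k = 2, since [rate_step] starts from k =
   2. *)
elim: k k0 => // -[_ _|k IHk _].
  rewrite invr1 mul1r le_max; apply/orP; left.
  rewrite frob_sqr -[leRHS](expect_cst P) le_eqVlt; apply/orP; left; apply/eqP.
  by congr (expect P); apply/funext => w; rewrite X1.
case: k IHk => [_|k IHk]; first exact: e2.
by apply: (rate_step _ MC C0 (IHk isT) (eS _ _)).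
Qed.
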